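(* Suppose $X_{1:p}=(X_1,\ldots,X_p)$ with $X_j=T_j(Z_j)$ for a Gaussian vector, or more generally a pairwise Gaussian vector, $Z_{1:p}=(Z_1,\ldots,Z_p)$ with $\mathbb E[Z_j]=0$, $\mathbb E[Z_j^2]=1$, and some deterministic functions $T_j$ with $0<\mathrm{Var}(T_j(Z_j))<\infty$. Let $\Sigma^z$ be the covariance matrix of $Z_{1:p}$. Then, for $\nu$ the counting measure on $\{1,\ldots,p\}$ and any symmetric $W=(W_{j,k})_{p\times p}$ with $W_{j,k}\ge0$, $$\lambda_{\min}(\Sigma^z\circ W)\le\rho^{NL}_{\min}(X_{1:p},\nu,W),\qquad \rho^{NL}_{\max}(X_{1:p},\nu,W)\le\lambda_{\max}(\Sigma^z\circ W),$$ and these inequalities become equalities when all the $T_j$ are almost surely invertible. In particular, for all functions $f_j$ with $\mathbb E f_j(X_j)=0$ and $0<\mathbb E f_j^2(X_j)<\infty$, $$\lambda_{\min}(\Sigma^z)\sum_{j=1}^p\mathbb E f_j^2(X_j)\le\mathbb E\Big(\sum_{j=1}^pf_j(X_j)\Big)^2\le\lambda_{\max}(\Sigma^z)\sum_{j=1}^p\mathbb E f_j^2(X_j).$$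
   Context: A random vector $(Z_1,\ldots,Z_p)$ is pairwise Gaussian if $(Z_j,Z_k)$ is bivariate Gaussian for all pairs $(j,k)$. $\circ$ is the Schur (entrywise) product; $\lambda_{\max},\lambda_{\min}$ are the largest and smallest eigenvalues. $T_j$ is almost surely invertible if $Z_j$ can be recovered almost surely as a (measurable) function of $T_j(Z_j)$. For the counting measure $\nu$, $\rho^{NL}_{\max}(X_{1:p},\nu,W)=\sup_{f_1,\ldots,f_p}\lambda_{\max}\big((\rho(f_j(X_j),f_k(X_k))W_{j,k})_{p\times p}\big)$ and $\rho^{NL}_{\min}(X_{1:p},\nu,W)=\inf_{f_1,\ldots,f_p}\lambda_{\min}\big((\rho(f_j(X_j),f_k(X_k))W_{j,k})_{p\times p}\big)$, where $\rho$ is the Pearson correlation and $f_j$ ranges over deterministic functions with $\mathbb E[f_j(X_j)]=0$ and $0<\mathbb E[f_j^2(X_j)]<\infty$. *)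

(* Defs.v *)
From HB Require Import structures.
From mathcomp Require Import all_boot all_order all_algebra.
From mathcomp Require Import all_classical all_reals all_analysis.
Set Implicit Arguments.
Unset Strict Implicit.
Unset Printing Implicit Defensive.
Import Order.TTheory GRing.Theory Num.Theory.
Import numFieldNormedType.Exports.

Local Open Scope classical_set_scope.
Local Open Scope ring_scope.

Section eigenvalues.
Context {R : realType}.

(* Meant for symmetric A : 'M_p with 0 < p, whose real spectrum is finite and
   nonempty, so that sup and inf are the largest and smallest eigenvalues. *)
Definition lambda_max p (A : 'M[R]_p) : R := sup [set a | eigenvalue A a].
Definition lambda_min p (A : 'M[R]_p) : R := inf [set a | eigenvalue A a].

Definition schur_prod p (A B : 'M[R]_p) : 'M[R]_p := map2_mx *%R A B.

End eigenvalues.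

Section gaussian.
Context {d : measure_display} {Omega : measurableType d} {R : realType}.
Variable P : probability Omega R.

(* Degenerate (constant) Gaussians are allowed.  They need a separate case:
   by convention normal_prob m 0 is the uniform law on [0, 1], not the Dirac
   mass at m. *)
Definition gaussian_law (m s : R) : set R -> \bar R :=
  if s == 0 then \d_m else normal_prob m s.

Definition gaussian_rv (X : Omega -> R) :=
  exists m s : R, forall A : set R, measurable A ->
    pushforward P X A = gaussian_law m s A.

Definition gaussian_vector p (Z : 'I_p -> {RV P >-> R}) :=
  forall a : 'I_p -> R, gaussian_rv (fun w => \sum_(i < p) a i * Z i w).

Definition bivariate_gaussian (X Y : {RV P >-> R}) :=
  forall a b : R, gaussian_rv (fun w => a * X w + b * Y w).

(* The diagonal pairs j = k are included: they force each Z j to be Gaussian,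
   which matters only when p = 1. *)
Definition pairwise_gaussian p (Z : 'I_p -> {RV P >-> R}) :=
  forall j k : 'I_p, bivariate_gaussian (Z j) (Z k).

Lemma gaussian_vector_pairwise p (Z : 'I_p -> {RV P >-> R}) :
  gaussian_vector Z -> pairwise_gaussian Z.
Proof.
move=> gZ j k a b.
have := gZ (fun i => a * (i == j)%:R + b * (i == k)%:R).
congr (gaussian_rv _); apply/funext => w.
have sum1 (c : R) (l : 'I_p) : \sum_(i < p) c * (i == l)%:R * Z i w = c * Z l w.
  rewrite (bigD1 l)//= eqxx mulr1 big1 ?addr0// => i /negbTE ->.
  by rewrite mulr0 mul0r.
by under eq_bigr do rewrite mulrDl; rewrite big_split /= !sum1.
Qed.

End gaussian.

Section correlation.
Context {d : measure_display} {Omega : measurableType d} {R : realType}.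
Variable P : probability Omega R.

Definition covariance_mx p (Z : 'I_p -> Omega -> R) : 'M[R]_p :=
  \matrix_(j, k) fine (covariance P (Z j) (Z k)).

Definition pearson (X Y : Omega -> R) : R :=
  fine (covariance P X Y)
  / (Num.sqrt (fine (variance P X)) * Num.sqrt (fine (variance P Y))).

Definition correlation_mx p (Y : 'I_p -> Omega -> R) : 'M[R]_p :=
  \matrix_(j, k) pearson (Y j) (Y k).

Definition centered_sq_integrable (X : Omega -> R) (f : R -> R) :=
  [/\ measurable_fun [set: R] f,
      'E_P[fun w => f (X w)]%E = 0%E,
      (0 < 'E_P[fun w => (f (X w) ^+ 2)%R])%E &
      ('E_P[fun w => (f (X w) ^+ 2)%R] < +oo)%E].

(* The nonlinear extremal correlations for the counting measure on 'I_p. *)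
Definition rhoNL_max p (X : 'I_p -> Omega -> R) (W : 'M[R]_p) : \bar R :=
  ereal_sup [set (lambda_max (schur_prod
      (correlation_mx (fun j w => f j (X j w))) W))%:E | f in
    [set f : 'I_p -> R -> R | forall j, centered_sq_integrable (X j) (f j)]].

Definition rhoNL_min p (X : 'I_p -> Omega -> R) (W : 'M[R]_p) : \bar R :=
  ereal_inf [set (lambda_min (schur_prod
      (correlation_mx (fun j w => f j (X j w))) W))%:E | f in
    [set f : 'I_p -> R -> R | forall j, centered_sq_integrable (X j) (f j)]].

Definition as_invertible (Z : Omega -> R) (T : R -> R) :=
  exists2 g : R -> R, measurable_fun [set: R] g &
    {ae P, forall w, g (T (Z w)) = Z w}.

End correlation.

(* Main.v *)
(* Each g(Z_j) has Hermite coefficients m_n, and E[g(Z_j) h(Z_k)] is the sum over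
   n of rho^n m_n(g) m_n(h), rho being the covariance of Z_j and Z_k; only the law
   of the pair matters, so pairwise Gaussianity is enough.  Hence a weighted
   quadratic form in centered functions is a sum over n >= 1 of quadratic forms of
   matrices W o Sigma^(o n).  Each is bounded by lambda_max(W o Sigma) |x|^2, since
   a Schur product with Sigma is an average of the forms x |-> (x_j Z_j)_j.  The
   expansion is needed only for trigonometric polynomials, where it is the power
   series of exp, because these are dense in L^2 of any law on the line.  Minima
   follow by changing W into -W, and equality by the choice f_j(X_j) = Z_j. *)
Require Import Defs.
From HB Require Import structures.
From mathcomp Require Import all_boot all_order all_algebra.
From mathcomp Require Import all_classical all_reals all_analysis.
From mathcomp Require Import measurable_realfun ring lra.
Set Implicit Arguments.
Unset Strict Implicit.
Unset Printing Implicit Defensive.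
Import Order.TTheory GRing.Theory Num.Theory.
Import numFieldNormedType.Exports.

Local Open Scope classical_set_scope.
Local Open Scope ring_scope.

(** * Largest eigenvalue of a symmetric matrix *)

(** The joint law of a pair may be degenerate (covariance 1 or -1), so no bivariate density is used,
    and Hermite polynomials never appear. A function [cos (b + (u * X + v * Y))] depends on one
    linear combination only, and this is Gaussian on the line by the very definition of a Gaussian
    pair; one-dimensional characteristic functions, obtained from Stein's identity, are therefore
    enough. The free phase [b] produces sines and constants from cosines and keeps everything real.
    Two obstacles shape the estimates. The term n = 0 carries [W] alone, which the constant for
    [Sigma] and [W] does not control, and trigonometric approximations of a centered function need
    not be centered. Hence the inequalities are first proved for covariances, where the term n = 0
    cancels. Moreover, after [W] is changed into [- W] the constant can be negative, so the sums of
    squares on the right may not be enlarged; they are matched exactly at every n because [Sigma]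
    has unit diagonal. Infinite sums are never exchanged: partial sums are compared, then the limit
    is taken. *)

Section rayleigh.
Context {R : realType}.
Implicit Types p : nat.

Lemma cvg_sumr (T : Type) (F : set_system T) {FF : Filter F} (I : Type)
    (r : seq I) (f : I -> T -> R) (l : I -> R) :
  (forall i, f i x @[x --> F] --> l i) ->
  \sum_(i <- r) f i x @[x --> F] --> \sum_(i <- r) l i.
Proof. by move=> fl; apply: cvg_big => //; exact: add_continuous. Qed.

(** The vector is a plain function, so that random vectors [x j * Z j w] and families of
    coefficients can be substituted directly. *)
Definition quad p (A : 'M[R]_p) (x : 'I_p -> R) : R :=
  \sum_(j < p) \sum_(k < p) A j k * (x j * x k).

Lemma quadZ p (A : 'M[R]_p) (t : R) x :
  quad A (fun j => t * x j) = t ^+ 2 * quad A x.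
Proof.
rewrite /quad mulr_sumr; apply: eq_bigr => j _; rewrite mulr_sumr.
by apply: eq_bigr => k _; ring.
Qed.

Lemma quadD_delta p (A : 'M[R]_p) (x : 'I_p -> R) (i : 'I_p) (t : R) :
  A^T = A ->
  quad A (fun j => x j + t * (j == i)%:R) =
  quad A x + 2 * t * (\sum_(j < p) x j * A j i) + t ^+ 2 * A i i.
Proof.
move=> symA.
have sum_delta (F : 'I_p -> R) : \sum_(k < p) F k * (k == i)%:R = F i.
  rewrite (bigD1 i)//= eqxx mulr1 big1 ?addr0// => k /negbTE ->.
  by rewrite mulr0.
have -> : quad A (fun j => x j + t * (j == i)%:R) =
    quad A x + \sum_(j < p) \sum_(k < p) (A j k * x j * t) * (k == i)%:R
    + \sum_(j < p) (\sum_(k < p) A j k * t * x k) * (j == i)%:R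
    + \sum_(j < p) (\sum_(k < p) (A j k * t ^+ 2 * (k == i)%:R)) * (j == i)%:R.
  rewrite /quad -!big_split/=; apply: eq_bigr => j _.
  rewrite !mulr_suml -!big_split/=; apply: eq_bigr => k _.
  by ring.
under [X in _ + X + _ + _]eq_bigr do rewrite sum_delta.
rewrite !sum_delta.
have -> : \sum_(j < p) A j i * x j * t = t * \sum_(j < p) x j * A j i.
  by rewrite mulr_sumr; apply: eq_bigr => j _; ring.
have -> : \sum_(j < p) A i j * t * x j = t * \sum_(j < p) x j * A j i.
  rewrite mulr_sumr; apply: eq_bigr => j _.
  by rewrite -{1}symA mxE; ring.
by ring.
Qed.

Lemma quad_eigen p (A : 'M[R]_p) (a : R) (v : 'rV[R]_p) : v *m A = a *: v ->
  quad A (v 0) = a * \sum_(j < p) v 0 j ^+ 2.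
Proof.
move=> va; rewrite /quad exchange_big/= mulr_sumr; apply: eq_bigr => k _.
have /rowP/(_ k) := va; rewrite !mxE expr2 mulrA => <-.
by rewrite mulr_suml; apply: eq_bigr => j _; ring.
Qed.

Lemma sum_sqr_gt0 p (v : 'rV[R]_p) : v != 0 -> 0 < \sum_(j < p) v 0 j ^+ 2.
Proof.
move=> v0; rewrite lt_neqAle sumr_ge0 ?andbT; last by move=> *; exact: sqr_ge0.
apply: contra_neq v0 => /esym/eqP.
rewrite psumr_eq0; last by move=> *; exact: sqr_ge0.
move=> /allP v0; apply/rowP => j; rewrite mxE; apply/eqP.
by rewrite -sqrf_eq0; apply: v0; rewrite mem_index_enum.
Qed.

Lemma continuous_quad p (A : 'M[R]_p) : continuous (fun v : 'rV[R]_p => quad A (v 0)).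
Proof.
have cc (j : 'I_p) : continuous (fun v : 'rV[R]_p => v 0 j : R).
  exact: coord_continuous.
move=> v; rewrite /quad.
apply: (@cvg_sumr _ (nbhs v)) => j; apply: (@cvg_sumr _ (nbhs v)) => k.
by apply: cvgM; [exact: cvg_cst|apply: cvgM; exact: cc].
Qed.

Lemma quad1 p (x : 'I_p -> R) : quad 1%:M x = \sum_(j < p) x j ^+ 2.
Proof.
apply: eq_bigr => j _; rewrite (bigD1 j)//= mxE eqxx mul1r big1 ?addr0//.
by move=> k kj; rewrite mxE eq_sym (negbTE kj) mul0r.
Qed.

(** The unit sphere is compact, and nonempty because [0 < p], so the continuous form has a maximiser
    [c] there. Homogeneity of degree 2 extends the inequality to all nonzero vectors. *)
Lemma rayleigh_max p (A : 'M[R]_p) : (0 < p)%N -> A^T = A ->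
  exists2 c : 'rV[R]_p, \sum_(j < p) c 0 j ^+ 2 = 1 &
  forall x, quad A x <= quad A (c 0) * \sum_(j < p) x j ^+ 2.
Proof.
move=> p0 symA.
pose S := [set v : 'rV[R]_p | \sum_(j < p) v 0 j ^+ 2 = 1].
have SE : S = (fun v : 'rV[R]_p => quad 1%:M (v 0)) @^-1` [set 1].
  by apply/seteqP; split => v; rewrite /S/= quad1.
have S0 : S !=set0.
  exists (delta_mx 0 (Ordinal p0)); rewrite /S/= (bigD1 (Ordinal p0))//= mxE !eqxx.
  rewrite expr1n big1 ?addr0// => j j0.
  by rewrite mxE (negbTE j0) andbF expr0n.
have cS : compact S.
  apply: bounded_closed_compact; last first.
    rewrite SE; apply: closed_comp; last exact: closed_eq.
    by move=> v _; exact: continuous_quad.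
  exists 1; split => //= M M1 v Sv.
  rewrite [leLHS]/Num.norm/= mx_normrE; apply/bigmax_leP; split => /=.
    by rewrite (le_trans _ (ltW M1)).
  move=> -[i j] _ /=; rewrite (le_trans _ (ltW M1))//.
  rewrite -(@expr_le1 _ 2)// real_normK ?num_real// ord1 -Sv (bigD1 j)//= lerDl.
  by rewrite sumr_ge0// => *; exact: sqr_ge0.
have [] := @compact_EVT_max _ R (fun v : 'rV[R]_p => quad A (v 0)) S S0 cS.
  by apply: continuous_subspaceT => v; exact: continuous_quad.
move=> c; rewrite inE => Sc cmax; exists c => // x.
pose v : 'rV[R]_p := \row_j x j.
have xv : x = v 0 by apply/funext => j; rewrite mxE.
rewrite xv; have [->|v0] := eqVneq v 0.
  rewrite [leLHS]big1 => [|j _]; last first.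
    by rewrite big1// => k _; rewrite mxE mul0r mulr0.
  by rewrite big1 ?mulr0// => k _; rewrite mxE expr0n.
have s0 := sum_sqr_gt0 v0.
pose s := Num.sqrt (\sum_(j < p) v 0 j ^+ 2).
have s2 : s ^+ 2 = \sum_(j < p) v 0 j ^+ 2 by rewrite sqr_sqrtr// ltW.
have sgt0 : 0 < s by rewrite sqrtr_gt0.
have /cmax : (\row_j (s^-1 * v 0 j)) \in S.
  rewrite inE /S/=; under eq_bigr do rewrite mxE exprMn.
  by rewrite -mulr_sumr -s2 -exprMn mulVf ?expr1n// gt_eqF.
have -> : (\row_j (s^-1 * v 0 j) : 'rV[R]_p) 0 = (fun j => s^-1 * v 0 j).
  by apply/funext => j; rewrite mxE.
by rewrite quadZ -s2 exprVn -ler_pdivlMl ?invr_gt0 ?exprn_gt0// invrK mulrC.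
Qed.

(** First-order condition at a maximiser: moving coordinate [i] by [t] gives a quadratic polynomial
    in [t], nonnegative and without constant term, so its linear coefficient is zero. *)
Lemma rayleigh_eigen p (A : 'M[R]_p) (c : 'rV[R]_p) : A^T = A ->
  \sum_(j < p) c 0 j ^+ 2 = 1 ->
  (forall x, quad A x <= quad A (c 0) * \sum_(j < p) x j ^+ 2) ->
  c *m A = quad A (c 0) *: c.
Proof.
move=> symA c1 cmax; apply/rowP => i; rewrite !mxE.
set mu := quad A (c 0).
have key t : 0 <= 2 * t * (mu * c 0 i - \sum_(j < p) c 0 j * A j i)
    + t ^+ 2 * (mu - A i i).
  have := cmax (fun j => c 0 j + t * (j == i)%:R).
  rewrite quadD_delta// -[X in _ <= _ * X]quad1 quadD_delta ?trmx1// quad1 c1 -/mu.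
  have -> : \sum_(j < p) c 0 j * (1%:M : 'M[R]_p) j i = c 0 i.
    rewrite (bigD1 i)//= mxE eqxx mulr1 big1 ?addr0// => j ji.
    by rewrite mxE (negbTE ji) mulr0.
  rewrite mxE eqxx mulr1n => h; rewrite -subr_ge0 in h.
  by apply: le_trans h _; rewrite le_eqVlt; apply/orP; left; apply/eqP; ring.
move: key; set a := mu * c 0 i - _; set b := mu - A i i => key.
suff : a = 0 by move=> /eqP; rewrite subr_eq0 => /eqP.
apply/eqP; case: (eqVneq a 0) => // a0; exfalso.
(* Size of the step that refutes [a != 0]: since [e * |b| < |a|], at [t = - (sg a * e)] the linear
   term [- 2 * e * |a|] outweighs the quadratic one, which is at most [e * |a|]. *)
pose e := `|a| / (`|b| + 1).
have b1 : 0 < `|b| + 1 by rewrite ltr_wpDl.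
have e0 : 0 < e by rewrite divr_gt0// normr_gt0.
have eb : e * `|b| < `|a|.
  rewrite /e mulrAC ltr_pdivrMr// mulrDr mulr1 ltrDl ?normr_gt0//.
have := key (- (Num.sg a * e)); rewrite sqrrN exprMn sqr_sg a0 mul1r.
have aE : Num.sg a * a = `|a| by rewrite normrEsg.
have -> : 2 * - (Num.sg a * e) * a = - (2 * e * `|a|) by rewrite -aE; ring.
have : e ^+ 2 * b <= e * `|a|.
  rewrite expr2 -mulrA ler_pM2l//; apply: le_trans (ltW eb).
  by rewrite ler_pM2l// ler_norm.
have : 0 < e * `|a| by rewrite mulr_gt0// normr_gt0.
lra.
Qed.

(** The maximum of the Rayleigh quotient is an eigenvalue, and every eigenvalue is the quotient at
    its eigenvector. So the supremum that defines [lambda_max] is this maximum. *)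
Lemma lambda_max_attained p (A : 'M[R]_p) : (0 < p)%N -> A^T = A ->
  exists2 c : 'rV[R]_p, \sum_(j < p) c 0 j ^+ 2 = 1 &
  quad A (c 0) = lambda_max A /\
  forall x, quad A x <= lambda_max A * \sum_(j < p) x j ^+ 2.
Proof.
move=> p0 symA; have [c c1 cmax] := rayleigh_max p0 symA.
exists c => //.
suff -> : lambda_max A = quad A (c 0) by [].
have eigc : [set a | eigenvalue A a] (quad A (c 0)).
  apply/eigenvalueP; exists c; first exact: rayleigh_eigen.
  apply/eqP => c0; have := c1; rewrite c0 big1.
    by move=> /eqP; rewrite eq_sym oner_eq0.
  by move=> j _; rewrite mxE expr0n.
have ubc : ubound [set a | eigenvalue A a] (quad A (c 0)).
  move=> a /eigenvalueP[v va v0].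
  by have := cmax (v 0); rewrite (quad_eigen va) ler_pM2r// sum_sqr_gt0.
apply/eqP; rewrite eq_le; apply/andP; split.
  by apply: ge_sup => //; exists (quad A (c 0)).
by apply: ub_le_sup => //; exists (quad A (c 0)).
Qed.

Lemma quad_le_lambda_max p (A : 'M[R]_p) x : (0 < p)%N -> A^T = A ->
  quad A x <= lambda_max A * \sum_(j < p) x j ^+ 2.
Proof. by move=> p0 symA; have [c _ [_]] := lambda_max_attained p0 symA. Qed.

Lemma lambda_max_le p (A : 'M[R]_p) l : (0 < p)%N -> A^T = A ->
  (forall x, quad A x <= l * \sum_(j < p) x j ^+ 2) -> lambda_max A <= l.
Proof.
move=> p0 symA ql; have [c c1 [<- _]] := lambda_max_attained p0 symA.
by rewrite -[leRHS]mulr1 -c1.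
Qed.

Lemma lambda_minE p (A : 'M[R]_p) : lambda_min A = - lambda_max (- A).
Proof.
rewrite /lambda_min /lambda_max /inf; congr (- sup _).
have eigN (B : 'M[R]_p) a : eigenvalue B a -> eigenvalue (- B) (- a).
  move=> /eigenvalueP[v va v0]; apply/eigenvalueP; exists v => //.
  by rewrite mulmxN va scaleNr.
apply/seteqP; split => [_ [a/= /eigN ? <-]//|a/= /eigN]; rewrite opprK => ?.
by exists (- a) => //; rewrite opprK.
Qed.

End rayleigh.

(** * Characteristic function of Gaussian laws *)

Section whole_line.
Context {R : realType}.
Notation mu := (@lebesgue_measure R).

(** The fundamental theorem of calculus on growing intervals around [m], then dominated convergence
    with bound [|f|]. It replaces integration by parts on the whole line. *)
Lemma integral_derive_eq0 (F f : R -> R) (m : R) :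
  (forall x : R, is_derive x 1 F (f x)) -> continuous f ->
  mu.-integrable [set: R] (EFin \o f) ->
  F (m + n.+1%:R) @[n --> \oo] --> (0 : R) ->
  F (m - n.+1%:R) @[n --> \oo] --> (0 : R) ->
  \int[mu]_x f x = 0.
Proof.
move=> Ff cf intf Fy FNy.
have cF : continuous F.
  by move=> x; apply: differentiable_continuous; apply/derivable1_diffP; case: (Ff x).
have mf := measurable_int _ intf.
pose D (n : nat) : set R := `[m - n.+1%:R, m + n.+1%:R]%classic.
have mD n : measurable (D n) by exact: measurable_itv.
have DF n : (\int[mu]_x ((EFin \o f) \_ (D n)) x)%E = (F (m + n.+1%:R) - F (m - n.+1%:R))%:E.
  have lt : m - n.+1%:R < m + n.+1%:R.
    by rewrite ltrD2l (@lt_trans _ _ 0)// ?oppr_lt0 ltr0n.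
  rewrite -integral_mkcond /D (@continuous_FTC2 _ f F)//.
  - exact: continuous_subspaceT.
  - split; first by move=> x _; case: (Ff x).
    + by apply: cvg_at_right_filter; exact: cF.
    + by apply: cvg_at_left_filter; exact: cF.
  - by move=> x _; rewrite derive1E; case: (Ff x).
have [] := @dominated_convergence _ _ _ mu setT measurableT
  (fun n => (EFin \o f) \_ (D n)) (EFin \o f) (abse \o (EFin \o f)).
- move=> n; refine ((measurable_restrictT (EFin \o f) (mD n)).1 _).
  exact: measurable_funS mf.
- exact: mf.
- apply/aeW => x _; apply: cvg_near_cst.
  near=> n; rewrite /patch mem_set// /D/= in_itv/= -ler_distl.
  rewrite distrC; near: n.
  exists (Num.bound `|m - x|) => //= n /= bn.
  rewrite ltW// (lt_le_trans (archi_boundP _))// ler_nat.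
  exact: leqW.
- exact: integrable_abse.
- by apply/aeW => x n _; rewrite /patch; case: ifPn => //= _; rewrite normr0 lee_fin.
move=> _ _ cvgD.
have /= : (\int[mu]_x ((EFin \o f) \_ (D n)) x)%E @[n --> \oo] --> 0%:E.
  under eq_fun do rewrite DF.
  apply: cvg_EFin; first exact: nearW.
  by rewrite -(subr0 0); exact: cvgB.
move=> /(cvg_unique _ cvgD) => h.
by rewrite /Rintegral h.
Unshelve. all: by end_near. Qed.

End whole_line.


(** * Stein's identity and the first two moments of the normal density *)

Section normal_moments.
Context {R : realType} (m s : R).
Hypothesis s0 : s != 0.
Notation mu := (@lebesgue_measure R).
Notation pdf := (normal_pdf m s).

Let s2_gt0 : 0 < s ^+ 2. Proof. by rewrite exprn_even_gt0. Qed.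

Let pdfE x : pdf x = normal_peak s * expR (- ((x - m) ^+ 2 / (s ^+ 2 *+ 2))).
Proof. by rewrite normal_pdfE// /normal_fun mulNr. Qed.

Lemma mulr_expRN_le1 (w : R) : w * expR (- w) <= 1.
Proof.
rewrite expRN ler_pdivrMr ?expR_gt0// mul1r.
by rewrite (le_trans _ (expR_ge1Dx w))// lerDr.
Qed.

(** With [w = (x - m)^2 / (2 s^2)] this is [w * expR (- w) <= 1]. Decay of order 2 is enough to kill
    the boundary terms of functions of linear growth. *)
Lemma normal_pdf_sqr_le x : (x - m) ^+ 2 * pdf x <= s ^+ 2 *+ 2 * normal_peak s.
Proof.
have v0 : 0 < s ^+ 2 *+ 2 by rewrite pmulrn_lgt0.
rewrite pdfE; set w := _ / _; have -> : (x - m) ^+ 2 = s ^+ 2 *+ 2 * w.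
  by rewrite /w mulrC divfK// gt_eqF.
by rewrite mulrACA ler_piMr ?mulr_expRN_le1// mulr_ge0 ?normal_peak_ge0// ltW.
Qed.

Lemma is_derive_normal_pdf (x : R) :
  is_derive x 1 pdf (- ((x - m) / s ^+ 2) * pdf x).
Proof.
rewrite normal_pdfE//.
pose q (y : R) := (- (s ^+ 2 *+ 2)^-1) * (y - m) ^+ 2.
have -> : (fun y => normal_peak s * normal_fun m s y) =
    (normal_peak s *: (expR \o q)).
  by apply/funext => y; rewrite /normal_fun /q !fctE/= mulNr mulNr [in RHS]mulrC.
have dq : is_derive x 1 q (- ((x - m) / s ^+ 2)).
  have -> : q = (- (s ^+ 2 *+ 2)^-1) *: ((id - cst m) ^+ 2) by [].
  apply: is_derive_eq; rewrite /GRing.scale/= subr0 mulr1 expr1.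
  by rewrite !fctE -[s ^+ 2 *+ 2]mulr_natr -mulr_natl; field.
have dE := @is_derive1_comp _ expR q x _ _ (is_derive_expR _) dq.
apply: is_derive_eq; rewrite /GRing.scale/=.
have -> : q x = - (x - m) ^+ 2 / (s ^+ 2 *+ 2) by rewrite /q !mulNr mulrC.
by rewrite mulrA mulrC.
Qed.

(** With [w = (x - m)^2 / (4 s^2)] the exponential in [pdf] is [expR (- w)] squared. One factor
    absorbs the quadratic growth of [h]; the other is, up to its peak, the normal density of
    deviation [s * sqrt 2], which is integrable. [K] collects the constants. *)
Lemma integrable_normal_pdfM (h : R -> R) (C : R) : measurable_fun [set: R] h ->
  (forall x, `|h x| <= C * (1 + (x - m) ^+ 2)) ->
  mu.-integrable [set: R] (EFin \o (fun x => h x * pdf x)).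
Proof.
move=> mh hC.
have s2 : s * Num.sqrt 2 != 0 by rewrite mulf_neq0// gt_eqF// sqrtr_gt0.
have peak0 : normal_peak (s * Num.sqrt 2) != 0 by rewrite gt_eqF// normal_peak_gt0.
pose K := C * (1 + s ^+ 2 *+ 4) * normal_peak s / normal_peak (s * Num.sqrt 2).
apply: (@le_integrable _ _ R mu setT measurableT _
    (fun x => (K * normal_pdf m (s * Num.sqrt 2) x)%:E)).
- apply/measurable_EFinP/measurable_funM => //; exact: measurable_normal_pdf.
- move=> x _; rewrite lee_fin normrM (ger0_norm (normal_pdf_ge0 _ _ _)).
  apply: le_trans (ler_norm _).
  rewrite (normal_pdfE _ s2) /normal_fun /K.
  rewrite exprMn sqr_sqrtr// mulrA divfK// pdfE.
  have -> : expR (- (x - m) ^+ 2 / (s ^+ 2 * 2 *+ 2)) =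
      expR (- ((x - m) ^+ 2 / (s ^+ 2 *+ 4))).
    by rewrite mulNr -[s ^+ 2 * 2 *+ 2]mulr_natr -mulrA -natrM mulr_natr.
  have -> : expR (- ((x - m) ^+ 2 / (s ^+ 2 *+ 2))) =
      expR (- ((x - m) ^+ 2 / (s ^+ 2 *+ 4))) * expR (- ((x - m) ^+ 2 / (s ^+ 2 *+ 4))).
    rewrite -expRD -opprD -mulrDl -[s ^+ 2 *+ 4]mulr_natr -[s ^+ 2 *+ 2]mulr_natr.
    by congr (expR (- _)); field.
  set w := _ / (s ^+ 2 *+ 4).
  have wE : (x - m) ^+ 2 = s ^+ 2 *+ 4 * w.
    by rewrite /w mulrC divfK// gt_eqF// pmulrn_lgt0.
  have w0 : 0 <= w by rewrite divr_ge0 ?sqr_ge0// mulrn_wge0// ltW.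
  clearbody w.
  have C0 : 0 <= C.
    have := hC x; rewrite -ler_pdivrMr ?ltr_pwDl ?sqr_ge0//; apply: le_trans.
    by rewrite divr_ge0// addr_ge0// sqr_ge0.
  have e0 := expR_ge0 (- w); have we := mulr_expRN_le1 w.
  have e1 : expR (- w) <= 1 by rewrite -expR0 ler_expR oppr_le0.
  have p0 := normal_peak_ge0 s.
  apply: le_trans (ler_wpM2r _ (hC x)) _.
    by rewrite !mulr_ge0.
  rewrite wE -!mulrA ler_wpM2l// [normal_peak s * (_ * _)]mulrCA !mulrA.
  rewrite ler_wpM2r// ler_wpM2r//.
  have A0 : 0 <= s ^+ 2 *+ 4 by rewrite mulrn_wge0// ltW.
  have := ler_wpM2l A0 we; move: (s ^+ 2 *+ 4) => A; nra.
- rewrite (_ : (fun x => _) = (fun x => K%:E * (normal_pdf m (s * Num.sqrt 2) x)%:E)%E)//.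
  by apply: integrableZl => //; exact: integrable_normal_pdf.
Qed.


(** At distance N from [m] the density is at most a constant over N^2 and [h] at most [2 * C * N],
    so the product is of order 1/N. The sign [e] treats both ends at once. *)
Lemma normal_pdf_decay (h : R -> R) (C e : R) : e ^+ 2 = 1 ->
  (forall x, `|h x| <= C * (1 + `|x - m|)) ->
  h (m + e * n.+1%:R) * pdf (m + e * n.+1%:R) @[n --> \oo] --> (0 : R).
Proof.
move=> e1 hC.
have ne : `|e| = 1 by apply/eqP; rewrite -sqr_norm_eq1 e1.
pose K := C * 2 * (s ^+ 2 *+ 2 * normal_peak s).
apply/norm_cvg0P; apply: (@squeeze_cvgr _ _ _ _ (cst 0) (fun n => K * harmonic n)).
- apply: nearW => n; rewrite normr_ge0/= /harmonic.
  have n0 : 0 < n.+1%:R :> R by rewrite ltr0n.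
  rewrite -[_^-1]mul1r mulrA ler_pdivlMr// mulr1 normrM.
  rewrite (ger0_norm (normal_pdf_ge0 _ _ _)).
  have pd := normal_pdf_sqr_le (m + e * n.+1%:R).
  have p0 := normal_pdf_ge0 m s (m + e * n.+1%:R).
  have := hC (m + e * n.+1%:R); move: pd.
  rewrite (_ : m + e * n.+1%:R - m = e * n.+1%:R); last by rewrite addrAC subrr add0r.
  rewrite normrM ne mul1r (ger0_norm (ltW n0)) exprMn e1 mul1r.
  set N := n.+1%:R; set p := pdf _; set H := `|h _|; set B := s ^+ 2 *+ 2 * _.
  move=> NpB HC.
  have N1 : 1 <= N by rewrite /N ler1n.
  have H0 : 0 <= H by exact: normr_ge0.
  have C0 : 0 <= C.
    have := le_trans H0 HC; rewrite pmulr_lge0//; lra.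
  have CN : C * (1 + N) <= C * (2 * N) by rewrite ler_wpM2l//; lra.
  apply: (@le_trans _ _ (C * (2 * N) * p * N)).
    apply: ler_wpM2r; first exact: ltW.
    by apply: ler_wpM2r => //; exact: le_trans HC CN.
  have -> : C * (2 * N) * p * N = C * 2 * (N ^+ 2 * p) by ring.
  by rewrite /K -/B ler_wpM2l// mulr_ge0.
- exact: cvg_cst.
- by rewrite -[X in _ --> X](mulr0 K); apply: cvgM; [exact: cvg_cst|exact: cvg_harmonic].
Qed.

(** The derivative of [h * pdf] is [h' * pdf - (x - m) / s^2 * h * pdf]; its integral is zero
    because [h * pdf] vanishes at both ends. *)
Lemma normal_stein (h h' : R -> R) (C : R) :
  (forall x : R, is_derive x 1 h (h' x)) -> continuous h' ->
  (forall x, `|h x| <= C * (1 + `|x - m|)) -> (forall x, `|h' x| <= C) ->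
  \int[mu]_x ((x - m) * h x * pdf x) = s ^+ 2 * \int[mu]_x (h' x * pdf x).
Proof.
move=> hh' ch' hC h'C.
have ch : continuous h.
  by move=> x; apply: differentiable_continuous; apply/derivable1_diffP; case: (hh' x).
have cid_m : continuous (fun x : R => x - m).
  by move=> x; apply: cvgB; [exact: cvg_id|exact: cvg_cst].
have C0 : 0 <= C by exact: le_trans (h'C 0).
have mid_m : measurable_fun [set: R] (fun x : R => x - m).
  exact: continuous_measurable_fun.
have mh := continuous_measurable_fun ch.
have mh' := continuous_measurable_fun ch'.
have i1 : mu.-integrable [set: R] (EFin \o (fun x => h' x * pdf x)).
  apply: (@integrable_normal_pdfM _ C) => // x; rewrite (le_trans (h'C x))//.
  by rewrite ler_peMr// lerDl sqr_ge0.
have i2 : mu.-integrable [set: R] (EFin \o (fun x => (x - m) * h x * pdf x)).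
  apply: (@integrable_normal_pdfM _ (2 * C)); first exact: measurable_funM.
  move=> x; rewrite normrM.
  have a0 := normr_ge0 (x - m); have xC := hC x.
  rewrite -[(x - m) ^+ 2]real_normK ?num_real//.
  apply: le_trans (ler_wpM2l a0 xC) _.
  have : 0 <= C * (`|x - m| - 1) ^+ 2 by rewrite mulr_ge0// sqr_ge0.
  have : 0 <= C * (`|x - m| + 1) ^+ 2 by rewrite mulr_ge0// sqr_ge0.
  move: (`|x - m|) => a; nra.
have i2' : mu.-integrable [set: R]
    (EFin \o (fun x => (s ^+ 2)^-1 * ((x - m) * h x * pdf x))).
  rewrite (_ : _ \o _ = (fun x => (s ^+ 2)^-1%:E * ((x - m) * h x * pdf x)%:E)%E)//.
  exact: integrableZl.
have := @integral_derive_eq0 _ (fun x => h x * pdf x)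
  (fun x => h' x * pdf x - (s ^+ 2)^-1 * ((x - m) * h x * pdf x)) m.
rewrite RintegralB// RintegralZl// => stein.
have s2n0 : s ^+ 2 != 0 by rewrite gt_eqF.
apply: (canRL (mulVKf s2n0)); apply/esym/eqP; rewrite -subr_eq0; apply/eqP/stein.
- move=> x; have hx := hh' x; have px := is_derive_normal_pdf x.
  apply: is_derive_eq (@is_deriveM _ _ h pdf x 1 _ _ hx px) _.
  by rewrite /GRing.scale/=; field.
- move=> x; apply: cvgB.
    by apply: cvgM; [exact: ch'|exact: continuous_normal_pdf].
  apply: cvgM; first exact: cvg_cst.
  apply: cvgM; last exact: continuous_normal_pdf.
  by apply: cvgM; [exact: cid_m|exact: ch].
- rewrite (_ : _ \o _ = (fun x => (h' x * pdf x)%:E -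
    ((s ^+ 2)^-1 * ((x - m) * h x * pdf x))%:E)%E)//.
  exact: integrableB.
- under eq_fun => n do rewrite -[n.+1%:R]mul1r.
  by apply: normal_pdf_decay hC; rewrite expr1n.
- under eq_fun do rewrite -mulN1r.
  by apply: normal_pdf_decay hC; rewrite sqrrN expr1n.
Qed.

(** Stein's identity for the constant function 1; the variance below uses it for [x - m]. *)
Lemma normal_pdf_mean : \int[mu]_x ((x - m) * pdf x) = 0.
Proof.
have d0 (x : R) : is_derive x 1 (cst 1 : R -> R) (cst 0 x) by exact: is_derive_cst.
have cst_le (x : R) : `|cst 1 x : R| <= 1 * (1 + `|x - m|).
  by rewrite normr1 mul1r lerDl.
have cst0_le (x : R) : `|cst 0 x : R| <= 1 by rewrite normr0.
have := normal_stein d0 (fun x => cvg_cst _) cst_le cst0_le.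
have -> : \int[mu]_x (cst 0 x * pdf x) = 0.
  by under eq_Rintegral do rewrite mul0r; rewrite Rintegral_cst// mul0r.
rewrite mulr0 => <-.
by apply: eq_Rintegral => x _; rewrite mulr1.
Qed.

Lemma Rintegral_normal_pdf : \int[mu]_x pdf x = 1.
Proof. by rewrite /Rintegral integral_normal_pdf. Qed.

Lemma normal_pdf_variance : \int[mu]_x ((x - m) ^+ 2 * pdf x) = s ^+ 2.
Proof.
have d1 (x : R) : is_derive x 1 (fun x : R => x - m) (cst 1 x).
  have -> : (fun x : R => x - m) = id - cst m by [].
  by apply: is_derive_eq; rewrite subr0.
have id_le (x : R) : `|x - m| <= 1 * (1 + `|x - m|) by rewrite mul1r lerDr.
have cst_le (x : R) : `|cst 1 x : R| <= 1 by rewrite normr1.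
have := normal_stein d1 (fun x => cvg_cst _) id_le cst_le.
have -> : \int[mu]_x (cst 1 x * pdf x) = 1.
  by under eq_Rintegral do rewrite mul1r; exact: Rintegral_normal_pdf.
rewrite mulr1 => <-.
by apply: eq_Rintegral => x _; rewrite expr2.
Qed.

End normal_moments.

(** * Characteristic function of the normal density *)

Section normal_cos.
Context {R : realType} (m s : R).
Hypothesis s0 : s != 0.
Notation mu := (@lebesgue_measure R).
Notation pdf := (normal_pdf m s).

Let G (b t : R) := \int[mu]_x (cos (b + t * (x - m)) * pdf x).

Let is_derive_phase (b x t : R) :
  is_derive t 1 (fun u : R => b + u * (x - m)) (x - m).
Proof.
have -> : (fun u => b + u * (x - m)) = cst b + (x - m) *: id.
  by apply/funext => u; rewrite !fctE /GRing.scale/= mulrC.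
by apply: is_derive_eq; rewrite add0r /GRing.scale/= mulr1.
Qed.

Let is_derive_phase_x (b x t : R) :
  is_derive x 1 (fun u : R => b + t * (u - m)) t.
Proof.
have -> : (fun u => b + t * (u - m)) = cst b + t *: (id - cst m) by [].
by apply: is_derive_eq; rewrite add0r /GRing.scale/= subr0 mulr1.
Qed.

(* Differentiating under the integral brings down (x - m), which Stein's identity
   turns back into a derivative: G' = - s^2 t G. *)
Let is_derive_G (b t : R) : is_derive t 1 (G b) (- (s ^+ 2 * t * G b t)).
Proof.
pose f (u x : R) := cos (b + u * (x - m)) * pdf x.
pose df (u x : R) := - ((x - m) * sin (b + u * (x - m)) * pdf x).
have cphase u : continuous (fun x : R => b + u * (x - m)).
  move=> x; apply: differentiable_continuous; apply/derivable1_diffP.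
  by case: (is_derive_phase_x b x u).
have dfE (u x : R) : is_derive u 1 (f ^~ x) (df u x).
  have := @is_derive1_comp _ cos (fun u => b + u * (x - m)) u _ _
    (is_derive_cos _) (is_derive_phase b x u).
  move=> dc; have -> : f^~ x = pdf x *: (cos \o (fun u => b + u * (x - m))).
    by apply/funext => v; rewrite /f !fctE /GRing.scale/= mulrC.
  by apply: is_derive_eq; rewrite /GRing.scale/= /df; ring.
have intG : mu.-integrable [set: R] (EFin \o (fun x => `|x - m| * pdf x)).
  apply: (@integrable_normal_pdfM _ _ _ s0 _ 1).
    apply: measurableT_comp => //; apply: continuous_measurable_fun => x.
    by apply: cvgB; [exact: cvg_id|exact: cvg_cst].
  move=> x; rewrite mul1r normr_id -[(x - m) ^+ 2]real_normK ?num_real//.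
  have := sqr_ge0 (`|x - m| - 1); have := normr_ge0 (x - m).
  by move: `|x - m| => a; nra.
have intf u : mu.-integrable [set: R] (EFin \o f u).
  apply: (@integrable_normal_pdfM _ _ _ s0 _ 1).
    apply: continuous_measurable_fun => x.
    by apply: (continuous_comp (cphase u x)); exact: continuous_cos.
  by move=> x; rewrite mul1r (le_trans (cos_max _))// lerDl sqr_ge0.
have ti : `]t - 1, t + 1[%classic t.
  by rewrite /= in_itv/= ltrBlDr ltrDl ltr01.
have bnd u x : `|partial1of2 f u x| <= `|x - m| * pdf x.
  rewrite partial1of2E; have [_ ->] := dfE u x.
  rewrite /df normrN !normrM (ger0_norm (normal_pdf_ge0 _ _ _)).
  by rewrite ler_wpM2r ?normal_pdf_ge0// ler_piMr// sin_max.
have key := @differentiation_under_integral R _ _ mu f setT measurableT t _ _ ti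
   (fun u _ => intf u) (fun u x _ _ => let: DeriveDef d _ := dfE u x in d)
   _ (fun x => mulr_ge0 (normr_ge0 (x - m)) (normal_pdf_ge0 m s x)) intG
   (fun u x _ _ => bnd u x).
have der := @derivable_under_integral R _ _ mu f setT measurableT t _ _ ti
   (fun u _ => intf u) (fun u x _ _ => let: DeriveDef d _ := dfE u x in d)
   _ (fun x => mulr_ge0 (normr_ge0 (x - m)) (normal_pdf_ge0 m s x)) intG
   (fun u x _ _ => bnd u x).
apply: DeriveDef; first exact: der.
rewrite -derive1E [LHS]key.
have -> : \int[mu]_y partial1of2 f t y =
    \int[mu]_x ((- 1) * ((x - m) * sin (b + t * (x - m)) * pdf x)).
  apply: eq_Rintegral => x _; rewrite partial1of2E.
  by have [_ ->] := dfE t x; rewrite mulN1r.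
have dsin (x : R) : is_derive x 1 (fun x => sin (b + t * (x - m)))
    (t * cos (b + t * (x - m))).
  have := @is_derive1_comp _ sin (fun x => b + t * (x - m)) x _ _
    (is_derive_sin _) (is_derive_phase_x b x t).
  by rewrite mulrC.
have intsin : mu.-integrable [set: R]
    (EFin \o (fun x => (x - m) * sin (b + t * (x - m)) * pdf x)).
  apply: le_integrable intG => //.
    apply/measurable_EFinP/measurable_funM; last exact: measurable_normal_pdf.
    apply: continuous_measurable_fun => x; apply: cvgM.
      by apply: cvgB; [exact: cvg_id|exact: cvg_cst].
    by apply: (continuous_comp (cphase t x)); exact: continuous_sin.
  move=> x _; rewrite lee_fin !normrM normr_id.
  by rewrite ler_wpM2r// ler_piMr// sin_max.
rewrite RintegralZl//.
have csin : continuous (fun x => t * cos (b + t * (x - m))).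
  move=> x; apply: cvgM; first exact: cvg_cst.
  by apply: (continuous_comp (cphase t x)); exact: continuous_cos.
have sin_le x : `|sin (b + t * (x - m))| <= (1 + `|t|) * (1 + `|x - m|).
  rewrite (le_trans (sin_max _))//.
  have := normr_ge0 t; have := normr_ge0 (x - m); nra.
have cos_le x : `|t * cos (b + t * (x - m))| <= 1 + `|t|.
  rewrite normrM; have := cos_max (b + t * (x - m)).
  have := normr_ge0 t; nra.
rewrite (normal_stein s0 dsin csin sin_le cos_le).
under eq_Rintegral do rewrite -mulrA.
by rewrite RintegralZl//; [rewrite /G; ring|exact: intf].
Qed.

(** The equation G' = - s^2 t G is solved by the integrating factor [expR (s^2 u^2 / 2)]: the
    product [H] has derivative zero and equals [cos b] at 0. *)
Lemma normal_pdf_cos (b t : R) :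
  \int[mu]_x (cos (b + t * (x - m)) * pdf x) = cos b * expR (- (s ^+ 2 * t ^+ 2 / 2)).
Proof.
pose H u := expR (s ^+ 2 * u ^+ 2 / 2) * G b u.
have dH (u : R) : is_derive u 1 H 0.
  have d1 : is_derive u 1 (fun u => s ^+ 2 * u ^+ 2 / 2) (s ^+ 2 * u).
    have -> : (fun u => s ^+ 2 * u ^+ 2 / 2) = (s ^+ 2 / 2) *: (id ^+ 2).
      by apply/funext => v; rewrite !fctE /GRing.scale/=; ring.
    by apply: is_derive_eq; rewrite /GRing.scale/= expr1 mulr1; field.
  have d2 := @is_derive1_comp _ expR _ u _ _ (is_derive_expR _) d1.
  apply: is_derive_eq (@is_deriveM _ _ _ _ u 1 _ _ d2 (is_derive_G b u)) _.
  by rewrite /GRing.scale/=; ring.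
have := is_derive_0_is_cst t 0 dH.
rewrite /H expr0n mulr0 mul0r expR0 mul1r.
have -> : G b 0 = cos b.
  rewrite /G; under eq_Rintegral do rewrite mul0r addr0.
  rewrite RintegralZl ?Rintegral_normal_pdf ?mulr1//.
  exact: integrable_normal_pdf.
move=> <-; rewrite mulrAC -expRD subrr expR0 mul1r.
by [].
Qed.

End normal_cos.

(** * From the density to random variables with a Gaussian, possibly degenerate, law *)

Section gaussian_integral.
Context {R : realType}.
Notation mu := (@lebesgue_measure R).

Lemma integral_normal_prob (m s : R) (f : R -> R) :
  (normal_prob m s).-integrable [set: R] (EFin \o f) ->
  \int[normal_prob m s]_x f x = \int[mu]_x (f x * normal_pdf m s x).
Proof.
move=> intf; have dom := @normal_prob_dominates R m s.
have mpdf := measurable_normal_pdf m s.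
rewrite /Rintegral -(Radon_Nikodym_change_of_variables dom)//=.
congr fine; apply: ae_eq_integral => //.
- apply: emeasurable_funM; first exact: measurable_int intf.
  by apply: (measurable_int mu); exact: Radon_Nikodym_integrable.
- apply/measurable_EFinP/measurable_funM => //.
  by have /measurable_EFinP := measurable_int _ intf.
- under [X in ae_eq _ _ _ X]eq_fun do rewrite EFinM.
  apply: ae_eqe_mul2l => /=; rewrite Radon_NikodymE//=.
  case: cid => /= h [h1 h2 h3].
  apply: integral_ae_eq => //=; first exact/measurable_EFinP.
  by move=> E _ mE; rewrite -h3.
Qed.

Context d (Omega : measurableType d) (P : probability Omega R).

Lemma Rintegral_gaussian (U : Omega -> R) (m s : R) (h : R -> R) :
  measurable_fun [set: Omega] U ->
  (forall A : set R, measurable A -> pushforward P U A = gaussian_law m s A) ->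
  measurable_fun [set: R] h -> P.-integrable [set: Omega] (EFin \o (h \o U)) ->
  \int[P]_w h (U w) =
    if s == 0 then h m else \int[mu]_x (h x * normal_pdf m s x).
Proof.
move=> mU lawU mh inth.
have mU' : measurable_fun [set: Omega] (U : Omega -> measurableTypeR R) by exact: mU.
have mEh : measurable_fun [set: measurableTypeR R] (EFin \o h) by exact/measurable_EFinP.
have inth' := integrable_pushforward mU' mEh inth measurableT.
have E := integral_pushforward mU' mEh inth measurableT.
have -> : \int[P]_w h (U w) =
    fine (\int[pushforward P (U : Omega -> measurableTypeR R)]_y (EFin \o h) y)%E.
  by rewrite E.
case: ifPn => [s0|s0].
  rewrite (eq_measure_integral (\d_(m : measurableTypeR R)
    : {measure set (measurableTypeR R) -> \bar R})).
    by rewrite integral_dirac//= indicT mul1r.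
  by move=> A mA _; have := lawU A mA; rewrite /gaussian_law s0.
have lawE (A : set (measurableTypeR R)) : measurable A -> A `<=` setT ->
    pushforward P (U : Omega -> measurableTypeR R) A = normal_prob m s A.
  by move=> mA _; have := lawU A mA; rewrite /gaussian_law (negbTE s0).
rewrite (eq_measure_integral (normal_prob m s) lawE).
apply: integral_normal_prob.
have /integrableP[_ hoo] := inth'.
by apply/integrableP; split=> //; rewrite -(eq_measure_integral (normal_prob m s) lawE).
exact: mU.
Qed.

(** The parameters of the law are only known to exist; the mean forces [m = 0] and the second moment
    then equals [s ^+ 2], also for a Dirac law, where both sides are [cos b]. *)
Lemma gaussian_cos (U : Omega -> R) (b : R) : U \in Lfun P 2%:E ->
  gaussian_rv P U -> \int[P]_w U w = 0 ->
  \int[P]_w cos (b + U w) = cos b * expR (- ((\int[P]_w (U w ^+ 2)) / 2)).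
Proof.
move=> U2 [m [s lawU]] U0.
have U1 : U \in Lfun P 1 by apply: Lfun_subset12 => //; rewrite fin_num_measure.
have mU : measurable_fun [set: Omega] U.
  by have /Lfun1_integrable/measurable_int/measurable_EFinP := U1.
have intU : P.-integrable [set: Omega] (EFin \o U) by exact/Lfun1_integrable.
have intU2 := Lfun2_integrable_sqr U2.
have intcos : P.-integrable [set: Omega] (EFin \o (fun w => cos (b + U w))).
  apply: (@le_integrable _ _ _ P setT measurableT _ (EFin \o cst 1)).
  - apply/measurable_EFinP; apply: measurableT_comp; last exact: measurable_funD.
    by apply: continuous_measurable_fun; exact: continuous_cos.
  - by move=> w _; rewrite lee_fin/= normr1 cos_max.
  - exact: finite_measure_integrable_cst.
(* Testing the law on [x - m] shows, in the degenerate and the regular case alike, that [m] is the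
   mean. *)
have m0 : m = 0.
  have iUm : P.-integrable [set: Omega] (EFin \o ((fun x => x - m) \o U)).
    rewrite (_ : _ \o _ = (fun w => (U w)%:E - (cst m w)%:E)%E)//.
    by apply: integrableB => //; exact: finite_measure_integrable_cst.
  have := Rintegral_gaussian mU lawU
    (measurable_funB (@measurable_id _ _ _) (measurable_cst _)) iUm.
  rewrite RintegralB//; last exact: finite_measure_integrable_cst.
  rewrite U0 Rintegral_cst// [in X in _ * X]/= probability_setT/= mulr1 sub0r.
  case: ifPn => [_|s0]; last rewrite normal_pdf_mean//.
    by rewrite subrr => /eqP; rewrite oppr_eq0 => /eqP.
  by move=> /eqP; rewrite oppr_eq0 => /eqP.
subst m.
rewrite (Rintegral_gaussian (h := fun x => cos (b + x)) mU lawU)//; last first.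
  apply: measurableT_comp; last exact: measurable_funD.
  by apply: continuous_measurable_fun; exact: continuous_cos.
rewrite (Rintegral_gaussian (h := fun x => x ^+ 2) mU lawU)//.
case: ifPn => [_|s0].
  by rewrite addr0 expr0n mul0r oppr0 expR0 mulr1.
have := normal_pdf_cos 0 s0 b 1.
under eq_Rintegral do rewrite mul1r subr0.
move=> ->; rewrite expr1n mulr1.
have := normal_pdf_variance 0 s0.
by under eq_Rintegral do rewrite subr0; move=> ->.
Qed.

End gaussian_integral.

(** * Hermite expansion of trigonometric polynomials *)

Section trig_polynomials.
Context {R : realType}.

(* The n-th entry is the coefficient of the function on the n-th normalized
   Hermite polynomial, computed as the Gaussian mean of its n-th derivative
   divided by sqrt n!. *)
Inductive trig_coef : (R -> R) -> (nat -> R) -> Prop :=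
| trig_coef_cos a u b : trig_coef (fun x => a * cos (b + u * x))
    (fun n => a * (expR (- (u ^+ 2 / 2)) * u ^+ n * cos (b + n%:R * (pi / 2)))
              / Num.sqrt n`!%:R)
| trig_coefD g h m m' : trig_coef g m -> trig_coef h m' ->
    trig_coef (g \+ h) (m \+ m').

Lemma trig_coef_continuous g m : trig_coef g m -> continuous g.
Proof.
elim=> [a u b|{}g h {}m m' _ cg _ ch] x; last by apply: cvgD; [exact: cg|exact: ch].
apply: cvgM; first exact: cvg_cst.
apply: (@continuous_comp _ _ _ (fun x => b + u * x) cos); last exact: continuous_cos.
by apply: cvgD; [exact: cvg_cst|apply: cvgM; [exact: cvg_cst|exact: cvg_id]].
Qed.

Lemma trig_coef_measurable g m : trig_coef g m -> measurable_fun [set: R] g.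
Proof. by move=> gm; apply: continuous_measurable_fun; exact: trig_coef_continuous gm. Qed.

Lemma trig_coef_bounded g m : trig_coef g m -> exists C, forall x, `|g x| <= C.
Proof.
elim=> [a u b|{}g h {}m m' _ [C gC] _ [D hD]].
  by exists `|a| => x; rewrite normrM ler_piMr// cos_max.
by exists (C + D) => x; rewrite (le_trans (ler_normD _ _))// lerD.
Qed.

Lemma cosM (a b : R) : cos a * cos b = 2^-1 * (cos (a + b) + cos (a - b)).
Proof. by rewrite cosD cosB; field. Qed.

Lemma cosDnpi (a : R) n : cos (a + n%:R * pi) = (-1) ^+ n * cos a.
Proof.
elim: n => [|n IH]; first by rewrite mul0r addr0 expr0 mul1r.
by rewrite -natr1 mulrDl mul1r addrA cosDpi IH exprS mulN1r mulNr.
Qed.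

Lemma series_expR (z : R) : \sum_(0 <= n < N) (z ^+ n / n`!%:R) @[N --> \oo] --> expR z.
Proof. exact: (is_cvg_series_exp_coeff z). Qed.

(** Mehler's formula for two cosines. In the product the phases [n * pi / 2] add up to [n * pi],
    that is to a sign (-1)^n, or cancel. The series thus splits into exponential series at [- z] and
    [z], where [z = u * v * rho], and the two square roots combine into n!. The limit is written as
    values of characteristic functions at frequencies (u, v) and (u, -v). *)
Lemma series_cos_exp (a u b a' v c rho : R) :
  \sum_(0 <= n < N) rho ^+ n *
    ((a * (expR (- (u ^+ 2 / 2)) * u ^+ n * cos (b + n%:R * (pi / 2)))
        / Num.sqrt n`!%:R) *
     (a' * (expR (- (v ^+ 2 / 2)) * v ^+ n * cos (c + n%:R * (pi / 2)))
        / Num.sqrt n`!%:R)) @[N --> \oo] -->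
  a * a' * 2^-1 *
   (cos (b + c) * expR (- ((u ^+ 2 + v ^+ 2 + 2 * (u * v * rho)) / 2)) +
    cos (b - c) * expR (- ((u ^+ 2 + v ^+ 2 - 2 * (u * v * rho)) / 2))).
Proof.
pose z := u * v * rho.
pose K := a * a' * 2^-1 * (expR (- (u ^+ 2 / 2)) * expR (- (v ^+ 2 / 2))).
have termE n : rho ^+ n *
    ((a * (expR (- (u ^+ 2 / 2)) * u ^+ n * cos (b + n%:R * (pi / 2)))
        / Num.sqrt n`!%:R) *
     (a' * (expR (- (v ^+ 2 / 2)) * v ^+ n * cos (c + n%:R * (pi / 2)))
        / Num.sqrt n`!%:R)) =
    K * (cos (b + c) * ((- z) ^+ n / n`!%:R) + cos (b - c) * (z ^+ n / n`!%:R)).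
  have s0 : 0 < n`!%:R :> R by rewrite ltr0n fact_gt0.
  pose q : R := Num.sqrt n`!%:R.
  have q2 : n`!%:R = q * q by rewrite /q -expr2 sqr_sqrtr// ltW.
  have q0 : q != 0 by rewrite gt_eqF// sqrtr_gt0.
  rewrite -/q q2.
  have cc : cos (b + n%:R * (pi / 2)) * cos (c + n%:R * (pi / 2)) =
      2^-1 * ((-1) ^+ n * cos (b + c) + cos (b - c)).
    rewrite cosM -cosDnpi; congr (_ * (cos _ + cos _)); first by field.
    by ring.
  transitivity (K * 2 * (rho ^+ n * u ^+ n * v ^+ n) *
      (cos (b + n%:R * (pi / 2)) * cos (c + n%:R * (pi / 2))) /
      (q * q)).
    by rewrite /K; field.
  rewrite cc -!exprMn.
  have -> : rho * u * v = z by rewrite /z; ring.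
  by rewrite (exprNn z); field.
under eq_fun => N.
  under eq_bigr do rewrite termE.
  rewrite -mulr_sumr big_split/= -!mulr_sumr.
  over.
have -> : a * a' * 2^-1 *
   (cos (b + c) * expR (- ((u ^+ 2 + v ^+ 2 + 2 * z) / 2)) +
    cos (b - c) * expR (- ((u ^+ 2 + v ^+ 2 - 2 * z) / 2))) =
    K * (cos (b + c) * expR (- z) + cos (b - c) * expR z).
  have -> : - ((u ^+ 2 + v ^+ 2 + 2 * z) / 2) = - (u ^+ 2 / 2) + - (v ^+ 2 / 2) + - z.
    by field.
  have -> : - ((u ^+ 2 + v ^+ 2 - 2 * z) / 2) = - (u ^+ 2 / 2) + - (v ^+ 2 / 2) + z.
    by field.
  by rewrite !expRD /K; ring.
apply: cvgM; first exact: cvg_cst.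
by apply: cvgD; apply: cvgM; [exact: cvg_cst|exact: series_expR|exact: cvg_cst|exact: series_expR].
Qed.

End trig_polynomials.

(** * Expectations of products of trigonometric polynomials of a Gaussian pair *)

Section gaussian_pair.
Context d (Omega : measurableType d) (R : realType) (P : probability Omega R).

Lemma integrableRD (f g : Omega -> R) :
  P.-integrable [set: Omega] (EFin \o f) -> P.-integrable [set: Omega] (EFin \o g) ->
  P.-integrable [set: Omega] (EFin \o (fun w => f w + g w)).
Proof. by move=> intf intg; apply: (integrableD measurableT intf intg). Qed.

Lemma integrableRZ (f : Omega -> R) (a : R) :
  P.-integrable [set: Omega] (EFin \o f) ->
  P.-integrable [set: Omega] (EFin \o (fun w => a * f w)).
Proof. by move=> intf; apply: (integrableZl measurableT a intf). Qed.

Lemma Lfun2Z (f : Omega -> R) (a : R) : f \in Lfun P 2%:E ->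
  (fun w => a * f w) \in Lfun P 2%:E.
Proof.
move=> f2; have := @Lfun_scale _ _ _ P f a 2 _ f2; rewrite ler1n => /(_ isT).
by rewrite (_ : _ \o* f = (fun w => a * f w))//; apply/funext => w; rewrite /= mulrC.
Qed.

Lemma Lfun2D (f g : Omega -> R) : f \in Lfun P 2%:E -> g \in Lfun P 2%:E ->
  (fun w => f w + g w) \in Lfun P 2%:E.
Proof. by move=> f2 g2; rewrite -[fun w => _]/(f \+ g) rpredD ?lee1n. Qed.

Lemma bounded_integrable (f : Omega -> R) (C : R) :
  measurable_fun [set: Omega] f -> (forall w, `|f w| <= C) ->
  P.-integrable [set: Omega] (EFin \o f).
Proof.
move=> mf fC; apply: (@le_integrable _ _ _ P setT measurableT _ (EFin \o cst C)).
- exact/measurable_EFinP.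
- by move=> w _; rewrite lee_fin/= (le_trans (fC w))// ler_norm.
- exact: finite_measure_integrable_cst.
Qed.

Lemma trig_coef_comp_integrable (X : {RV P >-> R}) g m : trig_coef g m ->
  P.-integrable [set: Omega] (EFin \o (fun w => g (X w))).
Proof.
move=> gm; have [C gC] := trig_coef_bounded gm.
apply: (@bounded_integrable _ C) => //.
by apply: measurableT_comp => //; exact: trig_coef_measurable gm.
Qed.

Lemma trig_coef_compM_integrable (X Y : {RV P >-> R}) g m h m' :
  trig_coef g m -> trig_coef h m' ->
  P.-integrable [set: Omega] (EFin \o (fun w => g (X w) * h (Y w))).
Proof.
move=> gm hm'; have [C gC] := trig_coef_bounded gm.
have [D hD] := trig_coef_bounded hm'.
apply: (@bounded_integrable _ (C * D)) => //; last first.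
  by move=> w; rewrite normrM ler_pM.
apply: measurable_funM; apply: measurableT_comp => //.
  exact: trig_coef_measurable gm.
exact: trig_coef_measurable hm'.
Qed.

(** The case [X = Y] is included; it yields the statements about a single variable. *)
Definition standard_pair (X Y : {RV P >-> R}) (rho : R) :=
  [/\ (X : _ -> _) \in Lfun P 2%:E, (Y : _ -> _) \in Lfun P 2%:E, bivariate_gaussian X Y &
   [/\ \int[P]_w X w = 0, \int[P]_w Y w = 0, \int[P]_w (X w ^+ 2) = 1,
     \int[P]_w (Y w ^+ 2) = 1 & \int[P]_w (X w * Y w) = rho]].

(** The combination [u * X + v * Y] is Gaussian and centered, with second moment
    [u^2 + v^2 + 2 * u * v * rho], so the one-dimensional formula applies for every [rho]. *)
Lemma Rintegral_cos_pair X Y rho (u v b : R) : standard_pair X Y rho ->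
  \int[P]_w cos (b + (u * X w + v * Y w)) =
  cos b * expR (- ((u ^+ 2 + v ^+ 2 + 2 * (u * v * rho)) / 2)).
Proof.
move=> [X2 Y2 XY [X0 Y0 XX YY XYr]].
have fP : P setT \is a fin_num by exact: fin_num_measure.
have L1 (f : Omega -> R) : f \in Lfun P 2%:E -> P.-integrable setT (EFin \o f).
  by move=> /(Lfun_subset12 fP)/Lfun1_integrable.
have X2' : (fun w => u * X w) \in Lfun P 2%:E by exact: Lfun2Z.
have Y2' : (fun w => v * Y w) \in Lfun P 2%:E by exact: Lfun2Z.
have ixx : P.-integrable setT (EFin \o (fun w => u ^+ 2 * X w ^+ 2)).
  by apply: integrableRZ; exact: Lfun2_integrable_sqr.
have iyy : P.-integrable setT (EFin \o (fun w => v ^+ 2 * Y w ^+ 2)).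
  by apply: integrableRZ; exact: Lfun2_integrable_sqr.
have iXY : P.-integrable setT (EFin \o (fun w => X w * Y w)).
  by apply/Lfun1_integrable; exact: Lfun2_mul_Lfun1.
have ixy : P.-integrable setT (EFin \o (fun w => 2 * (u * v) * (X w * Y w))).
  exact: integrableRZ.
rewrite gaussian_cos.
- congr (_ * expR (- (_ / 2))).
  transitivity (\int[P]_w (u ^+ 2 * X w ^+ 2 + v ^+ 2 * Y w ^+ 2
     + 2 * (u * v) * (X w * Y w))).
    by apply: eq_Rintegral => w _; ring.
  rewrite RintegralD// ?RintegralD//; last exact: integrableRD.
  rewrite !RintegralZl// ?XX ?YY ?XYr ?mulr1 -?mulrA//.
  - exact: Lfun2_integrable_sqr.
  - exact: Lfun2_integrable_sqr.
- exact: Lfun2D.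
- exact: XY.
- by rewrite RintegralD// ?RintegralZl ?X0 ?Y0 ?mulr0 ?addr0//; exact: L1.
Qed.

Lemma trig_coef_mean X rho g m : standard_pair X X rho -> trig_coef g m ->
  \int[P]_w g (X w) = m 0%N.
Proof.
move=> XX; elim=> [a u b|{}g h {}m m' gm IHg hm' IHh]; last first.
  rewrite RintegralD// ?IHg ?IHh//.
    exact: trig_coef_comp_integrable gm.
  exact: trig_coef_comp_integrable hm'.
have i1 : P.-integrable setT (EFin \o (fun w => cos (b + u * X w))).
  have := trig_coef_comp_integrable X (trig_coef_cos 1 u b).
  by congr (_.-integrable _ _); apply/funext => w /=; rewrite mul1r.
rewrite RintegralZl// expr0 mulr1 mul0r addr0 fact0 sqrtr1 divr1; congr (_ * _).
(* Frequency 0 on the second copy of [X] leaves the one-variable formula. *)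
have := Rintegral_cos_pair u 0 b XX.
rewrite expr0n/= !mulr0 mul0r mulr0 !addr0 mulrC => <-.
by apply: eq_Rintegral => w _; rewrite mul0r addr0.
Qed.

(** Both sides are bilinear, so two inductions reduce the claim to single cosines. There
    product-to-sum turns the expectation into two characteristic function values, which
    [series_cos_exp] has identified as the sum of the series. *)
Lemma trig_coef_pair X Y rho g m h m' : standard_pair X Y rho ->
  trig_coef g m -> trig_coef h m' ->
  \sum_(0 <= n < N) rho ^+ n * (m n * m' n) @[N --> \oo] -->
  \int[P]_w (g (X w) * h (Y w)).
Proof.
move=> XY gm hm'; elim: gm => [a u b|g1 g2 m1 m2 gm1 IH1 gm2 IH2]; last first.
  have -> : \int[P]_w ((g1 \+ g2) (X w) * h (Y w)) =
      \int[P]_w (g1 (X w) * h (Y w)) + \int[P]_w (g2 (X w) * h (Y w)).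
    rewrite -RintegralD//; last 2 first.
    - exact: trig_coef_compM_integrable gm1 hm'.
    - exact: trig_coef_compM_integrable gm2 hm'.
    by apply: eq_Rintegral => w _; rewrite mulrDl.
  under eq_fun => N do
    (under eq_bigr do rewrite mulrDl mulrDr; rewrite big_split/=).
  exact: cvgD.
elim: hm' => [a' v c|h1 h2 m1 m2 hm1 IH1 hm2 IH2]; last first.
  have au := trig_coef_cos a u b.
  have -> : \int[P]_w (a * cos (b + u * X w) * (h1 \+ h2) (Y w)) =
      \int[P]_w (a * cos (b + u * X w) * h1 (Y w)) +
      \int[P]_w (a * cos (b + u * X w) * h2 (Y w)).
    rewrite -RintegralD//; last 2 first.
    - exact: trig_coef_compM_integrable au hm1.
    - exact: trig_coef_compM_integrable au hm2.
    by apply: eq_Rintegral => w _; rewrite mulrDr.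
  under eq_fun => N do
    (under eq_bigr do rewrite mulrDr mulrDr; rewrite big_split/=).
  exact: cvgD.
rewrite [X in _ --> X](_ : _ = a * a' * 2^-1 *
   (cos (b + c) * expR (- ((u ^+ 2 + v ^+ 2 + 2 * (u * v * rho)) / 2)) +
    cos (b - c) * expR (- ((u ^+ 2 + v ^+ 2 - 2 * (u * v * rho)) / 2)))).
  exact: series_cos_exp.
have icos (b' v' : R) : P.-integrable setT
    (EFin \o (fun w => cos (b' + (u * X w + v' * Y w)))).
  apply: (@bounded_integrable _ 1); last by move=> w; exact: cos_max.
  apply: measurableT_comp.
    by apply: continuous_measurable_fun; exact: continuous_cos.
  by apply: measurable_funD => //; apply: measurable_funD; exact: measurable_funM.
rewrite -(Rintegral_cos_pair u v (b + c) XY).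
have := Rintegral_cos_pair u (- v) (b - c) XY.
rewrite sqrrN mulrN mulNr mulrN => <-.
rewrite -RintegralD// -RintegralZl//; last exact: integrableRD.
apply: eq_Rintegral => w _; rewrite mulrACA cosM -!mulrA.
by congr (_ * (_ * (_ * (cos _ + cos _)))); ring.
Qed.

End gaussian_pair.

(** * Density of trigonometric polynomials in L2 *)

Section step_limits.
Context {R : realType}.

Lemma bernoulli_ge (x : R) N : 0 <= x <= 1 -> 1 - N%:R * x <= (1 - x) ^+ N.
Proof.
move=> /andP[x0 x1]; elim: N => [|N IH]; first by rewrite mul0r subr0 expr0.
rewrite exprS; apply: le_trans (ler_wpM2l _ IH); last by rewrite subr_ge0.
have : 0 <= N%:R * x ^+ 2 by rewrite mulr_ge0// sqr_ge0.
by rewrite -natr1; move: N%:R => M; nra.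
Qed.

(** Since [(1 - x)^N * (1 + x)^N <= 1], Bernoulli's lower bound for [(1 + x)^N] gives an upper bound
    for [(1 - x)^N]. *)
Lemma bernoulli_le (x : R) N : 0 <= x <= 1 -> (1 - x) ^+ N <= (1 + N%:R * x)^-1.
Proof.
move=> /andP[x0 x1].
have N0 : 0 < 1 + N%:R * x by rewrite ltr_pwDl// mulr_ge0.
rewrite -[leRHS]mul1r ler_pdivlMr//.
have h : 1 + N%:R * x <= (1 + x) ^+ N.
  elim: N {N0} => [|N IH]; first by rewrite mul0r addr0 expr0.
  rewrite exprS; have := ler_wpM2l (addr_ge0 ler01 x0) IH; apply: le_trans.
  have : 0 <= N%:R * x ^+ 2 by rewrite mulr_ge0// sqr_ge0.
  by rewrite -natr1; move: N%:R => M; nra.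
apply: (@le_trans _ _ ((1 - x) ^+ N * (1 + x) ^+ N)).
  by rewrite ler_wpM2l// exprn_ge0// subr_ge0.
rewrite -exprMn exprn_ile1//.
  by rewrite mulr_ge0 ?subr_ge0// addr_ge0.
by have := sqr_ge0 x; nra.
Qed.

(** With [s = sqrt r], the geometric sum gives [n * (1 - s) * s^n <= 1 - s^n <= 1]; hence
    [n * r^n <= s^n / (1 - s)]. *)
Lemma cvg_natM_geometric (r : R) : 0 <= r < 1 -> n%:R * r ^+ n @[n --> \oo] --> (0 : R).
Proof.
move=> /andP[r0 r1].
pose s := Num.sqrt r.
have s2 : s * s = r by rewrite -expr2 sqr_sqrtr.
have s0 : 0 <= s by exact: sqrtr_ge0.
have s1 : s < 1 by rewrite -sqrtr1 ltr_sqrt.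
have ns n : n%:R * (1 - s) * s ^+ n <= 1 - s ^+ n.
  elim: n => [|n IH]; first by rewrite !mul0r expr0 subrr.
  rewrite -natr1 exprS; have := ler_wpM2l s0 IH.
  have : 0 <= (1 - s) * (1 - s * s ^+ n).
    have sn1 : s ^+ n <= 1 by rewrite exprn_ile1// ltW.
    have sn0 : 0 <= s ^+ n by rewrite exprn_ge0.
    by rewrite mulr_ge0 ?subr_ge0 ?mulr_ile1 ?(ltW s1).
  by move: (s ^+ n) n%:R => S M; nra.
apply: (@squeeze_cvgr _ _ _ _ (cst 0) (fun n => (1 - s)^-1 * s ^+ n)).
- apply: nearW => n; rewrite /= mulr_ge0 ?exprn_ge0//=.
  rewrite -s2 exprMn mulrA ler_wpM2r ?exprn_ge0//.
  rewrite -[leRHS]mul1r ler_pdivlMr ?subr_gt0// mulrAC.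
  by rewrite (le_trans (ns n))// gerBl exprn_ge0.
- exact: cvg_cst.
- rewrite -(mulr0 (1 - s)^-1); apply: cvgM; first exact: cvg_cst.
  by apply: cvg_expr; rewrite ger0_norm.
Qed.

(* The extra factor n in the exponent makes the limit 0 also at t = 1/2. *)
Lemma cvg_step (t : R) : 0 <= t <= 1 ->
  (1 - t ^+ n) ^+ (n * 2 ^ n) @[n --> \oo] --> ((t < 2^-1)%R%:R : R).
Proof.
move=> /andP[t0 t1].
have tn n : 0 <= t ^+ n <= 1 by rewrite exprn_ge0//= exprn_ile1.
have nE n : (n * 2 ^ n)%:R * t ^+ n = n%:R * (2 * t) ^+ n.
  by rewrite natrM natrX exprMn mulrA.
have [t2|t2] := ltP t 2^-1.
- apply: (@squeeze_cvgr _ _ _ _ (fun n => 1 - n%:R * (2 * t) ^+ n) (cst 1)).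
  + apply: nearW => n; rewrite -nE bernoulli_ge//=.
    by have /andP[? ?] := tn n; rewrite exprn_ile1 ?subr_ge0// gerBl.
  + rewrite -[X in _ --> X](subr0 1); apply: cvgB; first exact: cvg_cst.
    apply: cvg_natM_geometric; rewrite mulr_ge0//=.
    by rewrite mulrC -ltr_pdivlMr// mul1r.
  + exact: cvg_cst.
- apply: (@squeeze_cvgr _ _ _ _ (cst 0) harmonic).
  + apply: nearW => n; have tn' := tn n; have /andP[? ?] := tn'.
    rewrite exprn_ge0 ?subr_ge0//=; apply: le_trans (bernoulli_le _ tn') _.
    rewrite /harmonic lef_pV2 ?posrE//; last by rewrite ltr_pwDl// mulr_ge0.
    rewrite nE -natr1 addrC lerD2l ler_peMr// exprn_ege1//.
    by rewrite mulrC -ler_pdivrMr// mul1r.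
  + exact: cvg_cst.
  + exact: cvg_harmonic.
Qed.

(** Stretching the period removes periodicity: once [|x - a| < n + 1], the argument lies within [pi]
    of 0 and its sine has the sign of [x - a]. The sequence is eventually constant. *)
Lemma cvg_sin_step (a x : R) :
  (sin ((x - a) / n.+1%:R) < 0)%R%:R @[n --> \oo] --> ((x < a)%R%:R : R).
Proof.
apply: cvg_near_cst; near=> n.
have n0 : 0 < n.+1%:R :> R by rewrite ltr0n.
have xn : `|x - a| < n.+1%:R.
  near: n; exists (Num.bound `|x - a|) => //= n bn.
  by rewrite (lt_le_trans (archi_boundP _))// ler_nat leqW.
have ypi : `|(x - a) / n.+1%:R| < pi.
  rewrite normrM normfV (gtr0_norm n0).
  rewrite ltr_pdivrMr//; apply: (lt_le_trans xn); apply: ler_peMl; first exact: ltW.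
  by apply: le_trans (pi_ge2 R); rewrite ler1n.
congr ((_ : bool)%:R); have [xa|xa] := ltP x a.
- have y0 : (x - a) / n.+1%:R < 0 by rewrite pmulr_llt0 ?invr_gt0// subr_lt0.
  rewrite -[X in sin X]opprK sinN oppr_lt0 sin_gt0_pi//.
  by rewrite oppr_gt0 y0/= -(ltr0_norm y0).
- apply/negbTE; rewrite -leNgt sin_ge0_pi//.
  have y0 : 0 <= (x - a) / n.+1%:R by rewrite divr_ge0 ?subr_ge0// ltW.
  by rewrite y0/= -(ger0_norm y0) ltW.
Unshelve. all: by end_near. Qed.

(** The density argument multiplies functions, and the coefficients of a product are not simple in
    those of its factors. They are hidden here and chosen again in [trig_coef_bound]. *)
Definition trig (g : R -> R) := exists m, trig_coef g m.

Lemma trig_cst (a : R) : trig (cst a).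
Proof.
have -> : cst a = (fun x => a * cos (0 + 0 * x)).
  by apply/funext => x; rewrite mul0r addr0 cos0 mulr1.
by eexists; exact: trig_coef_cos.
Qed.

Lemma trigD g h : trig g -> trig h -> trig (g \+ h).
Proof. by move=> [m gm] [m' hm']; exists (m \+ m'); exact: trig_coefD. Qed.

Lemma trig_cos (a b u : R) : trig (fun x => a * cos (b + u * x)).
Proof. by eexists; exact: trig_coef_cos. Qed.

(** Product-to-sum keeps products in the span of cosines, so polynomials in trigonometric
    polynomials are available. *)
Lemma trigM g h : trig g -> trig h -> trig (g \* h).
Proof.
move=> [m gm] [m' hm']; elim: gm => [a u b|g1 g2 m1 m2 _ IH1 _ IH2]; last first.
  rewrite (_ : _ \* h = (g1 \* h) \+ (g2 \* h)); first exact: trigD.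
  by apply/funext => x /=; rewrite mulrDl.
elim: hm' => [a' v c|h1 h2 m1 m2 _ IH1 _ IH2]; last first.
  rewrite (_ : _ \* (h1 \+ h2) = ((fun x => a * cos (b + u * x)) \* h1) \+
    ((fun x => a * cos (b + u * x)) \* h2)); first exact: trigD.
  by apply/funext => x /=; rewrite mulrDr.
rewrite (_ : _ \* _ =
    (fun x => (a * a' / 2) * cos ((b + c) + (u + v) * x)) \+
    (fun x => (a * a' / 2) * cos ((b - c) + (u - v) * x))).
  by apply: trigD; exact: trig_cos.
apply/funext => x /=; rewrite mulrACA cosM.
have -> : b + u * x + (c + v * x) = b + c + (u + v) * x by ring.
have -> : b + u * x - (c + v * x) = b - c + (u - v) * x by ring.
by ring.
Qed.

Lemma trigX g n : trig g -> trig (fun x => g x ^+ n).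
Proof.
move=> tg; elim: n => [|n IH]; first exact: (trig_cst 1).
rewrite (_ : (fun x => _) = g \* (fun x => g x ^+ n)); first exact: trigM.
by apply/funext => x; rewrite exprS.
Qed.

Lemma trig_half_sin (a l : R) : trig (fun x => (1 + sin ((x - a) / l)) / 2).
Proof.
rewrite (_ : (fun x => _) = (cst 2^-1 : R -> R) \+
    (fun x => 2^-1 * cos ((- (a / l) - pi / 2) + l^-1 * x))).
  by apply: trigD; [exact: trig_cst|exact: trig_cos].
apply/funext => x /=; rewrite -cosBpihalf mulrDl mul1r mulrC; congr (_ + _ * cos _).
by rewrite mulrDl mulNr; ring.
Qed.

(** The polynomials of [cvg_step], a device of elementary proofs of the Stone-Weierstrass theorem,
    at [t = (1 + sin) / 2]: the threshold [t < 1/2] becomes [sin < 0]. *)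
Lemma trig_step (a l : R) n :
  trig (fun x => (1 - ((1 + sin ((x - a) / l)) / 2) ^+ n) ^+ (n * 2 ^ n)).
Proof.
apply: trigX; rewrite (_ : (fun x => _) = (cst 1 : R -> R) \+
  ((cst (-1) : R -> R) \* (fun x => ((1 + sin ((x - a) / l)) / 2) ^+ n))).
  apply: trigD; first exact: trig_cst.
  by apply: trigM; [exact: trig_cst|apply: trigX; exact: trig_half_sin].
by apply/funext => x /=; rewrite mulN1r.
Qed.

End step_limits.

(** * The L2 closure of trigonometric polynomials and its stability *)

Section trig_density.
Context d (Omega : measurableType d) (R : realType) (P : probability Omega R).
Variable Z : {RV P >-> R}.

(** The integral stays in the extended reals, so that the distance makes sense before any
    integrability is known. *)
Definition dist2 (g h : R -> R) : \bar R :=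
  (\int[P]_w ((g (Z w) - h (Z w)) ^+ 2)%:E)%E.

Definition trig_dense (g : R -> R) := measurable_fun [set: R] g /\
  forall e : R, 0 < e -> exists2 v, trig v & (dist2 g v < e%:E)%E.

Lemma trig_measurable v : trig v -> measurable_fun [set: R] v.
Proof. by move=> [m]; exact: trig_coef_measurable. Qed.

Lemma measurable_sqr_diff (g h : R -> R) : measurable_fun [set: R] g ->
  measurable_fun [set: R] h ->
  measurable_fun [set: Omega] (fun w => ((g (Z w) - h (Z w)) ^+ 2)%:E).
Proof.
move=> mg mh; apply/measurable_EFinP.
apply: (measurableT_comp (@exprn_measurable R setT 2)).
by apply: measurable_funB; apply: measurableT_comp.
Qed.

Lemma dist2_le (c : R) (f g h k l : R -> R) : 0 <= c ->
  measurable_fun [set: R] g -> measurable_fun [set: R] h ->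
  measurable_fun [set: R] k -> measurable_fun [set: R] l ->
  (forall x, (f x) ^+ 2 <= c * ((g x - h x) ^+ 2 + (k x - l x) ^+ 2)) ->
  measurable_fun [set: R] f ->
  (\int[P]_w ((f (Z w)) ^+ 2)%:E <= c%:E * (dist2 g h + dist2 k l))%E.
Proof.
move=> c0 mg mh mk ml fle mf.
have m1 := measurable_sqr_diff mg mh.
have m2 := measurable_sqr_diff mk ml.
rewrite /dist2 -ge0_integralD//; try by move=> w _; rewrite lee_fin sqr_ge0.
rewrite -ge0_integralZl//; last 2 first.
- exact: emeasurable_funD.
- by move=> w _; rewrite adde_ge0// lee_fin sqr_ge0.
apply: ge0_le_integral => //.
- by move=> w _; rewrite lee_fin sqr_ge0.
- apply/measurable_EFinP; apply: (measurableT_comp (@exprn_measurable R setT 2)).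
  exact: measurableT_comp.
- by apply: measurable_funeM; exact: emeasurable_funD.
- by move=> w _; rewrite -EFinD -EFinM lee_fin fle.
Qed.

Lemma trig_dense_closed g : measurable_fun [set: R] g ->
  (forall e : R, 0 < e -> exists2 h, trig_dense h & (dist2 g h < e%:E)%E) ->
  trig_dense g.
Proof.
move=> mg gh; split => // e e0.
(* Since [(a + b)^2 <= 2 * (a^2 + b^2)], two errors [e / 4] add up to [e]. *)
have e4 : 0 < e / 4 by rewrite divr_gt0.
have [h [mh hv] gh_e] := gh _ e4.
have [v tv hv_e] := hv _ e4.
exists v => //; have mv := trig_measurable tv.
have mgv : measurable_fun [set: R] (fun x => g x - v x) by exact: measurable_funB.
apply: le_lt_trans (dist2_le (c := 2) (f := fun x => g x - v x) _ mg mh mh mv _ mgv) _ => //.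
  move=> x; have -> : g x - v x = (g x - h x) + (h x - v x) by ring.
  move: (g x - h x) (h x - v x) => a b; have := sqr_ge0 (a - b); nra.
have -> : e%:E = (2%:E * ((e / 4)%:E + (e / 4)%:E))%E.
  by rewrite -EFinD -EFinM; congr EFin; field.
by rewrite lte_pmul2l// lteD.
Qed.

Lemma trig_denseD g h : trig_dense g -> trig_dense h -> trig_dense (g \+ h).
Proof.
move=> [mg gv] [mh hv]; split; first exact: measurable_funD.
move=> e e0; have e4 : 0 < e / 4 by rewrite divr_gt0.
have [v tv gve] := gv _ e4; have [u tu hue] := hv _ e4.
exists (v \+ u); first exact: trigD.
have mv := trig_measurable tv; have mu := trig_measurable tu.
have mf : measurable_fun [set: R] (fun x => (g \+ h) x - (v \+ u) x).
  by apply: measurable_funB; exact: measurable_funD.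
apply: le_lt_trans (dist2_le (c := 2) (f := fun x => (g \+ h) x - (v \+ u) x)
  _ mg mv mh mu _ mf) _ => //.
  move=> x /=; have -> : g x + h x - (v x + u x) = (g x - v x) + (h x - u x) by ring.
  move: (g x - v x) (h x - u x) => a b; have := sqr_ge0 (a - b); nra.
have -> : e%:E = (2%:E * ((e / 4)%:E + (e / 4)%:E))%E.
  by rewrite -EFinD -EFinM; congr EFin; field.
by rewrite lte_pmul2l// lteD.
Qed.

Lemma trig_dense_trig v : trig v -> trig_dense v.
Proof.
move=> tv; split; first exact: trig_measurable.
move=> e e0; exists v => //; rewrite /dist2.
by under eq_integral do rewrite subrr expr0n; rewrite integral0 lte_fin.
Qed.

Lemma trig_denseZ a g : trig_dense g -> trig_dense (fun x => a * g x).
Proof.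
move=> [mg gv]; split; first exact: measurable_funM.
move=> e e0.
(* The added 1 covers [a = 0]. *)
have e4 : 0 < e / (a ^+ 2 + 1) by rewrite divr_gt0// ltr_wpDl// sqr_ge0.
have [v tv gve] := gv _ e4.
exists (fun x => a * v x).
  exact: (trigM (trig_cst a) tv).
have mv := trig_measurable tv.
have mf : measurable_fun [set: R] (fun x => a * g x - a * v x).
  by apply: measurable_funB; exact: measurable_funM.
apply: le_lt_trans (dist2_le (c := a ^+ 2 + 1) (f := fun x => a * g x - a * v x)
  _ mg mv mv mv _ mf) _ => //.
- by rewrite addr_ge0// sqr_ge0.
- move=> x /=; rewrite -mulrBr subrr expr0n addr0 exprMn ler_wpM2r ?sqr_ge0//.
  by rewrite lerDl.
- rewrite [X in (_ + X)%E](_ : _ = 0%E) ?adde0.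
    by rewrite -lte_pdivlMl ?ltr_wpDl ?sqr_ge0// -EFinM mulrC.
  by rewrite /dist2; under eq_integral do rewrite subrr expr0n; rewrite integral0.
Qed.

(** The closure is stable under dominated pointwise limits: [g] inherits the bound [G], so the
    squared differences are at most [4 * G^2], and dominated convergence makes the distances tend to
    0. *)
Lemma trig_dense_dominated (h : (R -> R)^nat) (g G : R -> R) :
  measurable_fun [set: R] g -> measurable_fun [set: R] G ->
  P.-integrable [set: Omega] (EFin \o (fun w => G (Z w) ^+ 2)) ->
  (forall n, trig_dense (h n)) -> (forall n x, `|h n x| <= G x) ->
  (forall x, h n x @[n --> \oo] --> g x) -> trig_dense g.
Proof.
move=> mg mG intG th hG hg; apply: trig_dense_closed => // e e0.
have gG x : `|g x| <= G x.
  have /cvg_norm := hg x => hgx; apply: (ler_cvg_to hgx (cvg_cst (G x))).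
  by apply: nearW => n; exact: hG.
have mh n : measurable_fun [set: R] (h n) by case: (th n).
have cvg_diff w : ((g (Z w) - h n (Z w)) ^+ 2)%:E @[n --> \oo] --> 0%E.
  apply: cvg_EFin; first exact: nearW.
  rewrite (_ : _ \o _ = (fun n => (g (Z w) - h n (Z w)) * (g (Z w) - h n (Z w)))); last first.
    by apply/funext => n /=; rewrite expr2.
  rewrite [X in _ --> X](_ : _ = (g (Z w) - g (Z w)) * (g (Z w) - g (Z w))).
    by apply: cvgM; (apply: cvgB; [exact: cvg_cst|exact: hg]).
  by rewrite subrr mulr0.
have le_diff w n : (`|((g (Z w) - h n (Z w)) ^+ 2)%:E| <= (4 * G (Z w) ^+ 2)%:E)%E.
  rewrite lee_fin ger0_norm ?sqr_ge0//.
  have := hG n (Z w); have := gG (Z w); rewrite !ler_norml.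
  move: (g _) (h _ _) (G _) => a b c /andP[? ?] /andP[? ?].
  by nra.
have int4 := integrableRZ 4 intG.
have [_ _] := @dominated_convergence _ _ _ P setT measurableT
  (fun n w => ((g (Z w) - h n (Z w)) ^+ 2)%:E) (cst 0%E)
  (fun w => (4 * G (Z w) ^+ 2)%:E)
  (fun n => measurable_sqr_diff mg (mh n)) (measurable_cst _)
  (aeW _ (fun w _ => cvg_diff w)) int4 (aeW _ (fun w n _ => le_diff w n)).
rewrite integral0 => dct.
have e_nbhs : nbhs (0 : \bar R)%E [set y | (y < e%:E)%E].
  by apply: open_nbhs_nbhs; split; [exact: open_ereal_lt_ereal|rewrite /= lte_fin].
have [N _ hN] := dct _ e_nbhs.
by exists (h N) => //; exact: (hN N (leqnn N)).
Qed.

End trig_density.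

(** * From square waves to indicators and to all square-integrable functions *)

Section trig_density_L2.
Context d (Omega : measurableType d) (R : realType) (P : probability Omega R).
Variable Z : {RV P >-> R}.
Notation trig_dense := (trig_dense Z).

Lemma trig_dense_bounded (h : (R -> R)^nat) (g : R -> R) :
  measurable_fun [set: R] g ->
  (forall n, trig_dense (h n)) -> (forall n x, 0 <= h n x <= 1) ->
  (forall x, h n x @[n --> \oo] --> g x) -> trig_dense g.
Proof.
move=> mg th h1; apply: (@trig_dense_dominated _ _ _ _ _ h g (cst 1)) => //.
  by under eq_fun do rewrite /= expr1n; exact: finite_measure_integrable_cst.
by move=> n x; rewrite ger0_norm /=; have /andP[] := h1 n x.
Qed.

(** A square wave, as the pointwise limit of the functions of [trig_step], which lie between 0 and
    1. *)
Lemma trig_dense_sin_step (a l : R) :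
  trig_dense (fun x => (sin ((x - a) / l) < 0)%R%:R).
Proof.
have msin : measurable_fun [set: R] (fun x => sin ((x - a) / l)).
  apply: measurableT_comp.
    by apply: continuous_measurable_fun; exact: continuous_sin.
  by apply: measurable_funM => //; exact: measurable_funB.
apply: (@trig_dense_bounded (fun n x =>
    (1 - ((1 + sin ((x - a) / l)) / 2) ^+ n) ^+ (n * 2 ^ n))).
- rewrite (_ : (fun x => _) = \1_[set x | sin ((x - a) / l) < 0]).
    apply: measurable_indic; rewrite -[X in measurable X]setTI.
    rewrite (_ : [set x | _] = (fun x => sin ((x - a) / l)) @^-1` `]-oo, 0[%classic).
      by apply: msin => //; exact: measurable_itv.
    by apply/seteqP; split => x /=; rewrite in_itv.
  by apply/funext => x; rewrite indicE mem_setE.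
- by move=> n; apply: trig_dense_trig; exact: trig_step.
- move=> n x; have := sin_geN1 ((x - a) / l); have := sin_le1 ((x - a) / l).
  move: (sin _) => y y1 y2.
  have t01 : 0 <= ((1 + y) / 2) ^+ n <= 1.
    by rewrite exprn_ge0 ?exprn_ile1//; lra.
  move: t01 => /andP[? ?].
  by rewrite exprn_ge0 ?exprn_ile1 ?subr_ge0// gerBl.
- move=> x; have y1 := sin_geN1 ((x - a) / l); have y2 := sin_le1 ((x - a) / l).
  have -> : (sin ((x - a) / l) < 0) = ((1 + sin ((x - a) / l)) / 2 < 2^-1).
    by apply/idP/idP; lra.
  by apply: cvg_step; apply/andP; split; lra.
Qed.

(** A second limit: square waves whose period grows without bound converge to the half-line. *)
Lemma trig_dense_indic_lt (a : R) : trig_dense \1_(`]-oo, a[%classic : set R).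
Proof.
apply: (@trig_dense_bounded (fun n x => (sin ((x - a) / n.+1%:R) < 0)%R%:R)).
- by apply: measurable_indic; exact: measurable_itv.
- by move=> n; exact: trig_dense_sin_step.
- by move=> n x; rewrite ler0n lern1 leq_b1.
- move=> x; rewrite indicE (_ : (x \in _) = (x < a)); first exact: cvg_sin_step.
  by rewrite mem_setE in_itv.
Qed.

(** Dynkin's theorem: open half-lines generate the Borel sets and are stable under intersection.
    Complements follow by linearity, countable disjoint unions by bounded pointwise limits. *)
Lemma trig_dense_indic (A : set R) : measurable A -> trig_dense \1_A.
Proof.
have mE : @measurable _ R = <<s @RGenInftyO.G R >> by exact: RGenInftyO.measurableE.
rewrite mE; move: A.
apply: (@dynkin_induction _ R (@RGenInftyO.G R) (fun A => trig_dense \1_A)).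
- exact: mE.
- move=> _ _ [x ->] [y ->]; exists (Num.min x y).
  by apply/seteqP; split => z /=; rewrite !in_itv/= lt_min => /andP.
- by rewrite indicT; apply: trig_dense_trig; exact: trig_cst.
- by move=> _ [x ->]; exact: trig_dense_indic_lt.
- move=> S _ dS.
  rewrite (_ : \1_(~` S) = (cst 1 : R -> R) \+ (fun x => (-1) * \1_S x)).
    apply: trig_denseD; last exact: trig_denseZ.
    by apply: trig_dense_trig; exact: trig_cst.
  apply/funext => x; rewrite /= mulN1r !indicE in_setC.
  by case: (x \in S); rewrite /= ?subrr ?subr0.
- move=> F mF tF dF.
  (* By disjointness a partial sum at [x] is either always 0 or jumps once to 1, at the only index
     whose set contains [x]. This gives both the bound by 1 and the limit. *)
  have sumE x : (forall n, \sum_(k < n) \1_(F k) x = 0 :> R) /\ ~ (\bigcup_k F k) x \/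
     exists2 k0, (forall n, \sum_(k < n) \1_(F k) x = (k0 < n)%N%:R :> R) & (\bigcup_k F k) x.
    have [[k0 _ Fx]|nFx] := pselect ((\bigcup_k F k) x); last first.
      left; split => // n; rewrite big1// => k _; rewrite indicE memNset//.
      by move=> Fx; apply: nFx; exists k.
    right; exists k0; last by exists k0.
    move=> n; case: ltnP => [k0n|nk0].
      rewrite (bigD1 (Ordinal k0n))//= indicE mem_set// big1 ?addr0// => k kk0.
      rewrite indicE memNset// => Fkx; move/negP: kk0; apply; apply/eqP/val_inj.
      by apply: (tF k k0) => //; exists x.
    rewrite big1// => k _; rewrite indicE memNset// => Fkx.
    have kk0 : (k : nat) = k0 by apply: (tF k k0) => //; exists x.
    by have := ltn_ord k; rewrite kk0 ltnNge nk0.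
  apply: (@trig_dense_bounded (fun n x => \sum_(k < n) \1_(F k) x)).
  + by apply: measurable_indic; exact: bigcupT_measurable.
  + elim=> [|n IH].
      under [X in trig_dense X]eq_fun do rewrite big_ord0.
      by apply: trig_dense_trig; exact: trig_cst.
    under [X in trig_dense X]eq_fun do rewrite big_ord_recr/=.
    exact: trig_denseD.
  + move=> n x; case: (sumE x) => [[-> _]|[k0 -> _]]; first by rewrite lexx ler01.
    by rewrite ler0n lern1 leq_b1.
  + move=> x; apply: cvg_near_cst; case: (sumE x) => [[h nFx]|[k0 h Fx]].
      by apply: nearW => n; rewrite h indicE memNset.
    by exists k0.+1 => // n /= k0n; rewrite h k0n indicE mem_set.
Qed.

Lemma trig_dense_sum (s : seq R) (f : R -> R -> R) :
  (forall y, trig_dense (f y)) -> trig_dense (fun x => \sum_(y <- s) f y x).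
Proof.
move=> df; elim: s => [|y s IH].
  under [X in trig_dense X]eq_fun do rewrite big_nil.
  by apply: trig_dense_trig; exact: trig_cst.
by under [X in trig_dense X]eq_fun do rewrite big_cons; exact: trig_denseD.
Qed.

Import HBNNSimple.

Lemma trig_dense_nnsfun (f : {nnsfun R >-> R}) : trig_dense f.
Proof.
rewrite (_ : (f : R -> R) =
    (fun x => \sum_(y <- finmap.enum_fset (fset_set (range f))) y * \1_(f @^-1` [set y]) x)).
  apply: trig_dense_sum => y; apply: trig_denseZ; apply: trig_dense_indic.
  exact: measurable_sfunP.
by apply/funext => x; rewrite fimfunE fsbig_finite//; exact: fimfunP.
Qed.

Lemma trig_dense_ge0 (g : R -> R) : measurable_fun [set: R] g ->
  (forall x, 0 <= g x) ->
  P.-integrable [set: Omega] (EFin \o (fun w => g (Z w) ^+ 2)) -> trig_dense g.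
Proof.
move=> mg g0 intg.
have mEg : measurable_fun [set: R] (EFin \o g) by exact/measurable_EFinP.
have Eg0 x : setT x -> (0 <= (EFin \o g) x)%E by move=> _; rewrite lee_fin.
apply: (@trig_dense_dominated _ _ _ _ _ (fun n => nnsfun_approx measurableT mEg n) g g) => //.
- by move=> n; exact: trig_dense_nnsfun.
- move=> n x; rewrite ger0_norm// -lee_fin nnsfun_approxE.
  exact: le_approx.
- move=> x; have := cvg_nnsfun_approx measurableT mEg Eg0 (I : setT x).
  by move=> /fine_cvg.
Qed.

(** Positive and negative parts: [dmax] is applied to [g] and to [- g], each part having its square
    below [g ^+ 2]. *)
Lemma trig_dense_L2 (g : R -> R) : measurable_fun [set: R] g ->
  P.-integrable [set: Omega] (EFin \o (fun w => g (Z w) ^+ 2)) -> trig_dense g.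
Proof.
move=> mg intg.
have dmax (h : R -> R) : measurable_fun [set: R] h ->
    (forall x, h x ^+ 2 = g x ^+ 2) -> trig_dense (fun x => Num.max (h x) 0).
  move=> mh hg; have mm : measurable_fun [set: R] (fun x => Num.max (h x) 0).
    exact: measurable_maxr.
  apply: trig_dense_ge0 => //; first by move=> x; rewrite le_max lexx orbT.
  apply: le_integrable intg => //.
    apply/measurable_EFinP; apply: (measurableT_comp (@exprn_measurable R setT 2)).
    exact: (measurableT_comp mm).
  move=> w _; rewrite lee_fin !ger0_norm ?sqr_ge0// -hg.
  by case: (leP (h (Z w)) 0) => // _; rewrite expr0n sqr_ge0.
rewrite (_ : g = (fun x => Num.max (g x) 0) \+
    (fun x => (-1) * Num.max (- g x) 0)).
  apply: trig_denseD; first exact: dmax.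
  apply: trig_denseZ; apply: dmax; first exact: measurableT_comp.
  by move=> x; rewrite sqrrN.
apply/funext => x /=; rewrite mulN1r; case: leP => gx; case: leP => gx'; lra.
Qed.

End trig_density_L2.

(** * Nonlinear functions of pairwise Gaussian vectors *)

Section L2_space.
Context d (Omega : measurableType d) (R : realType) (P : probability Omega R).
Implicit Types F G : Omega -> R.

Lemma sqr_integrable_Lfun2 F : measurable_fun [set: Omega] F ->
  P.-integrable [set: Omega] (EFin \o (fun w => F w ^+ 2)) -> F \in Lfun P 2%:E.
Proof.
move=> mF /integrableP[_ intF]; rewrite inE; apply/andP; split; rewrite inE//=.
rewrite /finite_norm unlock /Lnorm poweR_lty//; apply: le_lt_trans intF.
rewrite le_eqVlt; apply/orP; left; apply/eqP; apply: eq_integral => w _ /=.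
by rewrite powR_mulrn// normrX.
Qed.

Lemma Lfun2_integrable F : F \in Lfun P 2%:E -> P.-integrable [set: Omega] (EFin \o F).
Proof.
move=> F2; apply/Lfun1_integrable; apply: Lfun_subset12 => //.
exact: fin_num_measure.
Qed.

Lemma Lfun2M_integrable F G : F \in Lfun P 2%:E -> G \in Lfun P 2%:E ->
  P.-integrable [set: Omega] (EFin \o (fun w => F w * G w)).
Proof. by move=> F2 G2; apply/Lfun1_integrable; exact: Lfun2_mul_Lfun1. Qed.

Lemma integrable_Rsum (I : Type) (r : seq I) (F : I -> Omega -> R) :
  (forall i, P.-integrable [set: Omega] (EFin \o F i)) ->
  P.-integrable [set: Omega] (EFin \o (fun w => \sum_(i <- r) F i w)).
Proof.
move=> intF; elim: r => [|i r IH].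
  rewrite (_ : _ \o _ = cst 0%E); first exact: integrable0.
  by apply/funext => w /=; rewrite big_nil.
rewrite (_ : _ \o _ = EFin \o (fun w => F i w + \sum_(j <- r) F j w)).
  exact: integrableRD.
by apply/funext => w /=; rewrite big_cons.
Qed.

Lemma Rintegral_sum (I : Type) (r : seq I) (F : I -> Omega -> R) :
  (forall i, P.-integrable [set: Omega] (EFin \o F i)) ->
  \int[P]_w (\sum_(i <- r) F i w) = \sum_(i <- r) \int[P]_w F i w.
Proof.
move=> intF; elim: r => [|i r IH].
  under eq_Rintegral do rewrite big_nil.
  by rewrite big_nil Rintegral_cst// mul0r.
under eq_Rintegral do rewrite big_cons.
by rewrite big_cons RintegralD// ?IH//; exact: integrable_Rsum.
Qed.

Lemma Rintegral_sqrD (a b : R) F G : F \in Lfun P 2%:E -> G \in Lfun P 2%:E ->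
  \int[P]_w ((a * F w + b * G w) ^+ 2) =
  a ^+ 2 * \int[P]_w (F w ^+ 2) + 2 * a * b * \int[P]_w (F w * G w)
  + b ^+ 2 * \int[P]_w (G w ^+ 2).
Proof.
move=> F2 G2; have iF := Lfun2_integrable_sqr F2; have iG := Lfun2_integrable_sqr G2.
have iFG := Lfun2M_integrable F2 G2.
transitivity (\int[P]_w (a ^+ 2 * F w ^+ 2 + 2 * a * b * (F w * G w) + b ^+ 2 * G w ^+ 2)).
  by apply: eq_Rintegral => w _; ring.
rewrite RintegralD//; last 2 first.
- by apply: integrableRD; exact: integrableRZ.
- exact: integrableRZ.
rewrite RintegralD//; last 2 first.
- exact: integrableRZ.
- exact: integrableRZ.
by rewrite !RintegralZl.
Qed.

(** The quadratic form [nn] in (a, b) is nonnegative; two explicit choices of (a, b) replace a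
    discussion of its discriminant. *)
Lemma cauchy_schwarz F G : F \in Lfun P 2%:E -> G \in Lfun P 2%:E ->
  (\int[P]_w (F w * G w)) ^+ 2 <= \int[P]_w (F w ^+ 2) * \int[P]_w (G w ^+ 2).
Proof.
move=> F2 G2.
have nn a b : 0 <= a ^+ 2 * \int[P]_w (F w ^+ 2)
    + 2 * a * b * \int[P]_w (F w * G w) + b ^+ 2 * \int[P]_w (G w ^+ 2).
  by rewrite -Rintegral_sqrD//; apply: Rintegral_ge0 => w _; exact: sqr_ge0.
have a0 : 0 <= \int[P]_w (F w ^+ 2) by apply: Rintegral_ge0 => w _; exact: sqr_ge0.
have b0 : 0 <= \int[P]_w (G w ^+ 2) by apply: Rintegral_ge0 => w _; exact: sqr_ge0.
move: nn a0 b0; set A := \int[P]_w (F w ^+ 2); set B := \int[P]_w (G w ^+ 2).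
set C := \int[P]_w _ => nn.
rewrite le_eqVlt => /predU1P[A0 _|A0 _].
  (* If A = 0, this choice gives the form the value [- C^4 * (B + 2)], which is negative unless C =
     0. *)
  rewrite -A0 mul0r; have := nn (- (C * (B + 1))) (C ^+ 2); rewrite -A0 mulr0 add0r.
  move=> h; rewrite leNgt; apply/negP => C0.
  have B0 : 0 <= B by apply: Rintegral_ge0 => w _; exact: sqr_ge0.
  have C4 := mulr_gt0 C0 C0.
  have B2 : 0 < B + 2 by lra.
  have contra (c b : R) : 0 <= 2 * - (c * (b + 1)) * c ^+ 2 * c + (c ^+ 2) ^+ 2 * b ->
    0 < c ^+ 2 * c ^+ 2 * (b + 2) -> False by move=> ? ?; lra.
  exact: (contra _ _ h (mulr_gt0 C4 B2)).
(* Here the form takes the value [A * (A * B - C^2)]. *)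
have := nn C (- A); rewrite sqrrN => h.
have : 0 <= A * (A * B - C ^+ 2).
  by apply: le_trans h _; rewrite le_eqVlt; apply/orP; left; apply/eqP; ring.
by rewrite pmulr_rge0// subr_ge0.
Qed.

Lemma normr_Rintegral_le F G : F \in Lfun P 2%:E -> G \in Lfun P 2%:E ->
  `|\int[P]_w (F w * G w)| <=
  Num.sqrt (\int[P]_w (F w ^+ 2)) * Num.sqrt (\int[P]_w (G w ^+ 2)).
Proof.
move=> F2 G2; rewrite -sqrtrM; last by apply: Rintegral_ge0 => w _; exact: sqr_ge0.
by rewrite -sqrtr_sqr ler_wsqrtr// cauchy_schwarz.
Qed.

(** Continuity of the inner product: the difference is expanded so that each of its three terms
    contains an error [F - Fn] or [G - Gn], and Cauchy-Schwarz bounds each term. *)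
Lemma cvg_Rintegral_mul (Fn Gn : (Omega -> R)^nat) F G :
  (forall n, Fn n \in Lfun P 2%:E) -> (forall n, Gn n \in Lfun P 2%:E) ->
  F \in Lfun P 2%:E -> G \in Lfun P 2%:E ->
  \int[P]_w ((F w - Fn n w) ^+ 2) @[n --> \oo] --> (0 : R) ->
  \int[P]_w ((G w - Gn n w) ^+ 2) @[n --> \oo] --> (0 : R) ->
  \int[P]_w (Fn n w * Gn n w) @[n --> \oo] --> \int[P]_w (F w * G w).
Proof.
move=> Fn2 Gn2 F2 G2 FnF GnG.
have subL (H K : Omega -> R) : H \in Lfun P 2%:E -> K \in Lfun P 2%:E ->
    (fun w => H w - K w) \in Lfun P 2%:E.
  move=> H2 K2; rewrite (_ : (fun w => _) = (fun w => H w + (-1) * K w)).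
    by apply: Lfun2D => //; exact: Lfun2Z.
  by apply/funext => w; rewrite mulN1r.
have dF n := subL _ _ F2 (Fn2 n); have dG n := subL _ _ G2 (Gn2 n).
pose nF := Num.sqrt (\int[P]_w (F w ^+ 2)).
pose nG := Num.sqrt (\int[P]_w (G w ^+ 2)).
pose a n := Num.sqrt (\int[P]_w ((F w - Fn n w) ^+ 2)).
pose b n := Num.sqrt (\int[P]_w ((G w - Gn n w) ^+ 2)).
have a0 : a n @[n --> \oo] --> 0.
  by rewrite -(sqrtr0 R); apply: (cvg_comp _ _ FnF); exact: sqrt_continuous.
have b0 : b n @[n --> \oo] --> 0.
  by rewrite -(sqrtr0 R); apply: (cvg_comp _ _ GnG); exact: sqrt_continuous.
apply/subr_cvg0; apply/norm_cvg0P.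
apply: (@squeeze_cvgr _ _ _ _ (cst 0) (fun n => a n * b n + a n * nG + nF * b n)).
- apply: nearW => n; rewrite normr_ge0/=.
  have -> : \int[P]_w (Fn n w * Gn n w) - \int[P]_w (F w * G w) =
      \int[P]_w ((F w - Fn n w) * (G w - Gn n w)) - \int[P]_w ((F w - Fn n w) * G w)
      - \int[P]_w (F w * (G w - Gn n w)).
    have i1 := Lfun2M_integrable (dF n) (dG n).
    have i2 := Lfun2M_integrable (dF n) G2.
    have i3 := Lfun2M_integrable F2 (dG n).
    have i4 := Lfun2M_integrable F2 G2.
    have i5 := Lfun2M_integrable (Fn2 n) (Gn2 n).
    have i12 := integrableB measurableT i1 i2.
    have i123 := integrableB measurableT i12 i3.
    have -> : \int[P]_w (Fn n w * Gn n w) = \int[P]_w (F w * G w +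
        ((F w - Fn n w) * (G w - Gn n w) - (F w - Fn n w) * G w - F w * (G w - Gn n w))).
      by apply: eq_Rintegral => w _; ring.
    by rewrite RintegralD// RintegralB// RintegralB// addrAC subrr add0r.
  rewrite (le_trans (ler_normB _ _))// lerD//; last exact: normr_Rintegral_le.
  by rewrite (le_trans (ler_normB _ _))// lerD// normr_Rintegral_le.
- exact: cvg_cst.
- rewrite [X in _ --> X](_ : _ = 0 * 0 + 0 * nG + nF * 0); last by ring.
  apply: cvgD; first apply: cvgD.
  + exact: cvgM.
  + by apply: cvgM => //; exact: cvg_cst.
  + by apply: cvgM => //; exact: cvg_cst.
Qed.

End L2_space.

(** * The weighted quadratic inequality for functions of a pairwise Gaussian vector *)

Section gaussian_bound.
Context d (Omega : measurableType d) (R : realType) (P : probability Omega R).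
Variables (p : nat) (Z : 'I_p -> {RV P >-> R}) (S W : 'M[R]_p) (l : R).
Hypothesis Z_std : forall j k, standard_pair (Z j) (Z k) (S j k).
Hypothesis W_le : forall x, quad (schur_prod S W) x <= l * \sum_(j < p) x j ^+ 2.

Let Z2 j : (Z j : Omega -> R) \in Lfun P 2%:E.
Proof. by case: (Z_std j j). Qed.

Let Sdiag j : S j j = 1.
Proof.
case: (Z_std j j) => _ _ _ [_ _ <- _ <-].
by apply: eq_Rintegral => w _; rewrite expr2.
Qed.

(* The covariance matrix S is the mean of the rank-one matrices (Z_j Z_k), so
   the Schur product with S averages quadratic forms in the vectors (x_j Z_j). *)
Lemma quad_schur_covariance (A : 'M[R]_p) :
  (forall x, quad A x <= l * \sum_(j < p) x j ^+ 2) ->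
  forall x, quad (schur_prod A S) x <= l * \sum_(j < p) x j ^+ 2.
Proof.
move=> Al x.
have iZZ j k : P.-integrable [set: Omega] (EFin \o (fun w => Z j w * Z k w)).
  exact: Lfun2M_integrable.
have iterm j k : P.-integrable [set: Omega]
    (EFin \o (fun w => A j k * (x j * Z j w * (x k * Z k w)))).
  rewrite (_ : _ \o _ = EFin \o (fun w => A j k * (x j * x k) * (Z j w * Z k w))).
    exact: integrableRZ.
  by apply/funext => w /=; congr EFin; ring.
have isqr j : P.-integrable [set: Omega] (EFin \o (fun w => (x j * Z j w) ^+ 2)).
  by apply: Lfun2_integrable_sqr; exact: Lfun2Z.
have -> : quad (schur_prod A S) x = \int[P]_w quad A (fun j => x j * Z j w).
  rewrite Rintegral_sum; last by move=> j; exact: integrable_Rsum.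
  apply: eq_bigr => j _; rewrite Rintegral_sum//; apply: eq_bigr => k _.
  transitivity (\int[P]_w (A j k * (x j * x k) * (Z j w * Z k w))).
    rewrite RintegralZl// mxE; case: (Z_std j k) => _ _ _ [_ _ _ _ ->].
    by rewrite mulrAC.
  by apply: eq_Rintegral => w _; ring.
have -> : l * \sum_(j < p) x j ^+ 2 = \int[P]_w (l * \sum_(j < p) (x j * Z j w) ^+ 2).
  rewrite RintegralZl//; last exact: integrable_Rsum.
  rewrite Rintegral_sum//; congr (_ * _); apply: eq_bigr => j _.
  under eq_Rintegral do rewrite exprMn.
  rewrite RintegralZl//; last exact: Lfun2_integrable_sqr.
  by case: (Z_std j j) => _ _ _ [_ _ -> _ _]; rewrite mulr1.
apply: le_Rintegral => //.
- by apply: integrable_Rsum => j; exact: integrable_Rsum.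
- by apply: integrableRZ; exact: integrable_Rsum.
Qed.

(** Iterates [quad_schur_covariance] from [W_le]. The constant [l] survives every step, whatever its
    sign, because the averages of [(x j * Z j) ^+ 2] are exactly [x j ^+ 2]. The exponent starts at
    1, since nothing is known of [W] alone. *)
Lemma quad_schur_power n x :
  \sum_(j < p) \sum_(k < p) W j k * S j k ^+ n.+1 * (x j * x k)
    <= l * \sum_(j < p) x j ^+ 2.
Proof.
have: forall x, quad (\matrix_(j, k) (W j k * S j k ^+ n.+1)) x
    <= l * \sum_(j < p) x j ^+ 2.
  elim: n => [|n IH] {}x.
    apply: le_trans (W_le x); rewrite le_eqVlt; apply/orP; left; apply/eqP.
    by apply: eq_bigr => j _; apply: eq_bigr => k _; rewrite !mxE expr1 [S _ _ * _]mulrC.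
  have := quad_schur_covariance IH x; apply: le_trans.
  rewrite le_eqVlt; apply/orP; left; apply/eqP.
  apply: eq_bigr => j _; apply: eq_bigr => k _; rewrite !mxE.
  by rewrite (exprSr _ n.+1) !mulrA.
move=> /(_ x); apply: le_trans; rewrite le_eqVlt; apply/orP; left; apply/eqP.
by apply: eq_bigr => j _; apply: eq_bigr => k _; rewrite mxE.
Qed.

(** The term of index 0 is the product of the means, so what remains of the series is the
    covariance. *)
Lemma trig_coef_tail j k g m h m' : trig_coef g m -> trig_coef h m' ->
  \sum_(0 <= n < N) S j k ^+ n.+1 * (m n.+1 * m' n.+1) @[N --> \oo] -->
  \int[P]_w (g (Z j w) * h (Z k w)) - \int[P]_w g (Z j w) * \int[P]_w h (Z k w).
Proof.
move=> gm hm'.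
have -> : \int[P]_w g (Z j w) = m 0%N.
  exact: trig_coef_mean (Z_std j j) gm.
have -> : \int[P]_w h (Z k w) = m' 0%N.
  exact: trig_coef_mean (Z_std k k) hm'.
have := trig_coef_pair (Z_std j k) gm hm'.
rewrite -(cvg_shiftS (fun N => \sum_(0 <= n < N) _)).
under eq_fun do rewrite big_nat_recl// expr0 mul1r.
move=> h1.
suff : m 0%N * m' 0%N + \sum_(0 <= n < N) S j k ^+ n.+1 * (m n.+1 * m' n.+1)
    - m 0%N * m' 0%N @[N --> \oo] -->
    \int[P]_w (g (Z j w) * h (Z k w)) - m 0%N * m' 0%N.
  by under eq_fun => N do rewrite addrAC subrr add0r.
by apply: cvgB => //; exact: cvg_cst.
Qed.

(** For each n the coefficients of index n + 1 form one vector, to which [quad_schur_power] applies;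
    on the right the powers of the unit diagonal entries disappear. *)
Lemma trig_coef_bound (v : 'I_p -> R -> R) : (forall j, trig (v j)) ->
  \sum_(j < p) \sum_(k < p) W j k *
    (\int[P]_w (v j (Z j w) * v k (Z k w)) -
     \int[P]_w v j (Z j w) * \int[P]_w v k (Z k w)) <=
  l * \sum_(j < p) (\int[P]_w (v j (Z j w) * v j (Z j w)) -
     \int[P]_w v j (Z j w) * \int[P]_w v j (Z j w)).
Proof.
move=> /choice[m vm].
have lhs : \sum_(j < p) \sum_(k < p) W j k *
    (\sum_(0 <= n < N) S j k ^+ n.+1 * (m j n.+1 * m k n.+1)) @[N --> \oo] -->
    \sum_(j < p) \sum_(k < p) W j k *
    (\int[P]_w (v j (Z j w) * v k (Z k w)) -
     \int[P]_w v j (Z j w) * \int[P]_w v k (Z k w)).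
  apply: cvg_sumr => j; apply: cvg_sumr => k.
  by apply: cvgM; [exact: cvg_cst|exact: trig_coef_tail].
have rhs : l * (\sum_(j < p)
    \sum_(0 <= n < N) S j j ^+ n.+1 * (m j n.+1 * m j n.+1)) @[N --> \oo] -->
    l * \sum_(j < p) (\int[P]_w (v j (Z j w) * v j (Z j w)) -
     \int[P]_w v j (Z j w) * \int[P]_w v j (Z j w)).
  apply: cvgM; first exact: cvg_cst.
  by apply: cvg_sumr => j; exact: trig_coef_tail.
(* The inequality is proved for partial sums of the same length N, where the finite sums may be
   exchanged. *)
apply: (ler_cvg_to lhs rhs); apply: nearW => N.
have -> : \sum_(j < p) \sum_(0 <= n < N) S j j ^+ n.+1 * (m j n.+1 * m j n.+1) =
    \sum_(j < p) \sum_(0 <= n < N) m j n.+1 ^+ 2.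
  apply: eq_bigr => j _; apply: eq_bigr => n _.
  by rewrite Sdiag expr1n mul1r expr2.
rewrite [X in _ <= _ * X]exchange_big/= mulr_sumr.
under eq_bigr => j _ do under eq_bigr => k _ do rewrite mulr_sumr.
under eq_bigr => j _ do rewrite exchange_big/=.
rewrite exchange_big/=; apply: ler_sum => n _.
apply: le_trans (quad_schur_power n (fun j => m j n.+1)).
rewrite le_eqVlt; apply/orP; left; apply/eqP.
by apply: eq_bigr => j _; apply: eq_bigr => k _; rewrite mulrA.
Qed.

(** Passage to the L2 limit in [trig_coef_bound]: each [g j] is approximated with squared error
    below 1/(n + 1), and all the integrals involved are inner products. *)
Lemma gaussian_bound (g : 'I_p -> R -> R) :
  (forall j, measurable_fun [set: R] (g j)) ->
  (forall j, (fun w => g j (Z j w)) \in Lfun P 2%:E) ->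
  (forall j, \int[P]_w g j (Z j w) = 0) ->
  \sum_(j < p) \sum_(k < p) W j k * \int[P]_w (g j (Z j w) * g k (Z k w))
    <= l * \sum_(j < p) \int[P]_w (g j (Z j w) ^+ 2).
Proof.
move=> mg g2 g0.
have approx (nj : nat * 'I_p) : exists v, trig v /\
    (dist2 (Z nj.2) (g nj.2) v < nj.1.+1%:R^-1%:E)%E.
  have [_ /(_ nj.1.+1%:R^-1)] := trig_dense_L2 (mg nj.2) (Lfun2_integrable_sqr (g2 nj.2)).
  by rewrite invr_gt0 ltr0n => /(_ isT)[v tv vn]; exists v.
have [v0 v0P] := choice approx; pose v n j := v0 (n, j).
have tv n j : trig (v n j) := (v0P (n, j)).1.
have dv n j : (dist2 (Z j) (g j) (v n j) < n.+1%:R^-1%:E)%E := (v0P (n, j)).2.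
have v2 n j : (fun w => v n j (Z j w)) \in Lfun P 2%:E.
  have [mm vm] := tv n j; have [C vC] := trig_coef_bounded vm.
  have mv : measurable_fun [set: Omega] (fun w => v n j (Z j w)).
    by apply: measurableT_comp => //; exact: trig_measurable.
  apply: sqr_integrable_Lfun2 => //; apply: (@bounded_integrable _ _ _ _ _ (C ^+ 2)).
    exact: (measurableT_comp (@exprn_measurable R setT 2) mv).
  by move=> w; rewrite normrX lerXn2r// ?nnegrE// (le_trans _ (vC 0)).
have cst2 : (cst 1 : Omega -> R) \in Lfun P 2%:E by exact: Lfun_cst.
have cvg_dv j : \int[P]_w ((g j (Z j w) - v n j (Z j w)) ^+ 2) @[n --> \oo] --> (0 : R).
  apply: (@squeeze_cvgr _ _ _ _ (cst 0) harmonic); last 2 first.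
  - exact: cvg_cst.
  - exact: cvg_harmonic.
  apply: nearW => n; rewrite Rintegral_ge0/=; last by move=> w _; exact: sqr_ge0.
  rewrite -lee_fin /Rintegral fineK; first exact: ltW (dv n j).
  rewrite ge0_fin_numE; first exact: lt_trans (dv n j) (ltry _).
  by apply: integral_ge0 => w _; rewrite lee_fin sqr_ge0.
have cvg_vv j k : \int[P]_w (v n j (Z j w) * v n k (Z k w)) @[n --> \oo] -->
    \int[P]_w (g j (Z j w) * g k (Z k w)).
  by apply: cvg_Rintegral_mul.
(* The approximations are not centered, but their means, as inner products with the constant 1, tend
   to the mean 0 of [g j]. So their covariances tend to the plain product moments. *)
have cvg_v j : \int[P]_w (v n j (Z j w)) @[n --> \oo] --> 0.
  rewrite -(g0 j).
  have -> : \int[P]_w g j (Z j w) = \int[P]_w (g j (Z j w) * cst 1 w).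
    by apply: eq_Rintegral => w _; rewrite mulr1.
  rewrite [X in X @ _ --> _](_ : _ = (fun n => \int[P]_w (v n j (Z j w) * cst 1 w))).
    apply: (cvg_Rintegral_mul (Gn := fun=> cst 1)) => //.
    rewrite [X in X @ _ --> _](_ : _ = cst 0); first exact: cvg_cst.
    apply/funext => n; under eq_Rintegral do rewrite subrr expr0n.
    by rewrite Rintegral_cst// mul0r.
  by apply/funext => n; apply: eq_Rintegral => w _; rewrite mulr1.
have cvg_cov j k : \int[P]_w (v n j (Z j w) * v n k (Z k w)) -
    \int[P]_w v n j (Z j w) * \int[P]_w v n k (Z k w) @[n --> \oo] -->
    \int[P]_w (g j (Z j w) * g k (Z k w)).
  rewrite -[X in _ --> X]subr0 -[X in _ - X](mulr0 0).
  by apply: cvgB => //; exact: cvgM.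
have -> : l * \sum_(j < p) \int[P]_w (g j (Z j w) ^+ 2) =
    l * \sum_(j < p) \int[P]_w (g j (Z j w) * g j (Z j w)).
  by congr (_ * _); apply: eq_bigr => j _; apply: eq_Rintegral => w _; rewrite expr2.
have lhs : \sum_(j < p) \sum_(k < p) W j k * (\int[P]_w (v n j (Z j w) * v n k (Z k w)) -
    \int[P]_w v n j (Z j w) * \int[P]_w v n k (Z k w)) @[n --> \oo] -->
    \sum_(j < p) \sum_(k < p) W j k * \int[P]_w (g j (Z j w) * g k (Z k w)).
  apply: cvg_sumr => j; apply: cvg_sumr => k.
  by apply: cvgM; [exact: cvg_cst|exact: cvg_cov].
have rhs : l * (\sum_(j < p) (\int[P]_w (v n j (Z j w) * v n j (Z j w)) -
    \int[P]_w v n j (Z j w) * \int[P]_w v n j (Z j w))) @[n --> \oo] -->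
    l * \sum_(j < p) \int[P]_w (g j (Z j w) * g j (Z j w)).
  by apply: cvgM; [exact: cvg_cst|apply: cvg_sumr => j; exact: cvg_cov].
by apply: (ler_cvg_to lhs rhs); apply: nearW => n; exact: trig_coef_bound.
Qed.

End gaussian_bound.

(** * Covariances, variances and correlations as real integrals *)

Section correlation_facts.
Context d (Omega : measurableType d) (R : realType) (P : probability Omega R).

Lemma fine_expectation (F : Omega -> R) : fine 'E_P[F] = \int[P]_w F w.
Proof. by rewrite unlock. Qed.

Lemma fine_covariance (F G : Omega -> R) : 'E_P[F]%E = 0%E -> 'E_P[G]%E = 0%E ->
  fine (covariance P F G) = \int[P]_w (F w * G w).
Proof.
move=> F0 G0; rewrite unlock F0 G0 fine_expectation.
apply: eq_Rintegral => w _.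
by rewrite -[LHS]/((F w - 0) * (G w - 0)) !subr0.
Qed.

Lemma fine_variance (F : Omega -> R) : 'E_P[F]%E = 0%E ->
  fine (variance P F) = \int[P]_w (F w ^+ 2).
Proof.
by move=> F0; rewrite /variance fine_covariance.
Qed.

Lemma centered_sq_integrableP (X : Omega -> R) (f : R -> R) :
  measurable_fun [set: Omega] X -> centered_sq_integrable P X f ->
  [/\ (fun w => f (X w)) \in Lfun P 2%:E, \int[P]_w f (X w) = 0,
      0 < \int[P]_w (f (X w) ^+ 2) &
      'E_P[fun w => (f (X w) ^+ 2)%R]%E = (\int[P]_w (f (X w) ^+ 2))%:E].
Proof.
move=> mX [mf f0 f2_gt0 f2_lty].
have mF : measurable_fun [set: Omega] (fun w => f (X w)) by exact: measurableT_comp.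
have f2_fin : 'E_P[fun w => (f (X w) ^+ 2)%R]%E \is a fin_num.
  by rewrite ge0_fin_numE// ltW.
have f2E : 'E_P[fun w => (f (X w) ^+ 2)%R]%E = (\int[P]_w (f (X w) ^+ 2))%:E.
  by rewrite -fine_expectation fineK.
split => //; last by rewrite -lte_fin -f2E.
  apply: sqr_integrable_Lfun2 => //; apply/integrableP; split.
    by apply/measurable_EFinP; exact: (measurableT_comp (@exprn_measurable R setT 2) mF).
  move: f2_lty; rewrite unlock; apply: le_lt_trans.
  rewrite le_eqVlt; apply/orP; left; apply/eqP; apply: eq_integral => w _ /=.
  by rewrite ger0_norm ?sqr_ge0.
by rewrite -fine_expectation f0.
Qed.

Lemma schur_prod_symmetric p (A B : 'M[R]_p) : A^T = A -> B^T = B ->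
  (schur_prod A B)^T = schur_prod A B.
Proof. by move=> sA sB; apply/matrixP => j k; rewrite !mxE -{1}sA -{1}sB !mxE. Qed.

Lemma schur_prodrN p (A B : 'M[R]_p) : schur_prod A (- B) = - schur_prod A B.
Proof. by apply/matrixP => j k; rewrite !mxE mulrN. Qed.

Lemma correlation_mx_symmetric p (Y : 'I_p -> Omega -> R) :
  (correlation_mx P Y)^T = correlation_mx P Y.
Proof.
by apply/matrixP => j k; rewrite !mxE /pearson covarianceC [X in _ / X]mulrC.
Qed.

Lemma covariance_mx_symmetric p (Y : 'I_p -> Omega -> R) :
  (covariance_mx P Y)^T = covariance_mx P Y.
Proof. by apply/matrixP => j k; rewrite !mxE covarianceC. Qed.

Lemma rhoNL_minE p (X : 'I_p -> Omega -> R) (W : 'M[R]_p) :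
  rhoNL_min P X W = (- rhoNL_max P X (- W))%E.
Proof.
rewrite /rhoNL_min ereal_infEN; congr (- ereal_sup _)%E.
rewrite image_comp; apply: eq_imagel => f _ /=.
by rewrite lambda_minE -schur_prodrN opprK.
Qed.

End correlation_facts.

(** * Bounds for the nonlinear extremal correlations, and their sharpness *)

Section nonlinear_correlation.
Context (d : measure_display) (Omega : measurableType d) (R : realType).
Variables (P : probability Omega R) (p : nat) (Z : 'I_p -> {RV P >-> R}).
Variables (T : 'I_p -> R -> R) (X : 'I_p -> Omega -> R).
Hypothesis p_gt0 : (0 < p)%N.
Hypothesis Z_gaussian : pairwise_gaussian Z.
Hypothesis Z_mean : forall j, 'E_P[Z j]%E = 0%E.
Hypothesis Z_sq : forall j, 'E_P[fun w => (Z j w ^+ 2)%R]%E = 1%E.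
Hypothesis T_meas : forall j, measurable_fun [set: R] (T j).
Hypothesis X_def : forall j w, X j w = T j (Z j w).

Notation Sigma := (covariance_mx P (fun j => Z j)).

Let XE j : X j = (fun w => T j (Z j w)).
Proof. by apply/funext. Qed.

Let mX j : measurable_fun [set: Omega] (X j).
Proof. by rewrite XE; exact: measurableT_comp. Qed.

Let Z_Lfun2 j : (Z j : Omega -> R) \in Lfun P 2%:E.
Proof.
apply: sqr_integrable_Lfun2 => //; apply/integrableP; split.
  apply/measurable_EFinP.
  exact: (measurableT_comp (@exprn_measurable R setT 2)).
have : (1%E < +oo :> \bar R)%E by exact: ltry.
rewrite -(Z_sq j) unlock; apply: le_lt_trans.
rewrite le_eqVlt; apply/orP; left; apply/eqP; apply: eq_integral => w _ /=.
by rewrite ger0_norm ?sqr_ge0.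
Qed.

Let Z_std j k : standard_pair (Z j) (Z k) (Sigma j k).
Proof.
have Z0 i : \int[P]_w Z i w = 0.
  by have := fine_expectation P (Z i); rewrite Z_mean.
have ZZ i : \int[P]_w (Z i w ^+ 2) = 1 by rewrite -fine_expectation Z_sq.
by split => //; split=> //; rewrite mxE fine_covariance.
Qed.

Let Sigma_symmetric : Sigma^T = Sigma.
Proof. exact: covariance_mx_symmetric. Qed.

(** Each [x j * f j (X j)] is a centered function of [Z j]. The weights [x] serve two purposes:
    divided by standard deviations they produce correlations, and equal to 1 they produce the second
    moment of the sum. *)
Lemma centered_bound (W : 'M[R]_p) (f : 'I_p -> R -> R) (x : 'I_p -> R) :
  W^T = W -> (forall j, centered_sq_integrable P (X j) (f j)) ->
  \sum_(j < p) \sum_(k < p) W j k *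
      (x j * x k * \int[P]_w (f j (X j w) * f k (X k w))) <=
  lambda_max (schur_prod Sigma W) *
    \sum_(j < p) x j ^+ 2 * \int[P]_w (f j (X j w) ^+ 2).
Proof.
move=> symW cf.
have f2 j : (fun w => f j (X j w)) \in Lfun P 2%:E.
  by case: (centered_sq_integrableP (mX j) (cf j)).
have f0 j : \int[P]_w f j (X j w) = 0.
  by case: (centered_sq_integrableP (mX j) (cf j)).
pose g j (z : R) := x j * f j (T j z).
have gE j w : g j (Z j w) = x j * f j (X j w) by rewrite /g X_def.
have gF j : (fun w => g j (Z j w)) = (fun w => x j * f j (X j w)).
  by apply/funext => w.
have Sl y : quad (schur_prod Sigma W) y <=
    lambda_max (schur_prod Sigma W) * \sum_(j < p) y j ^+ 2.
  by apply: quad_le_lambda_max => //; exact: schur_prod_symmetric.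
have := @gaussian_bound _ _ _ P p Z Sigma W _ Z_std Sl g.
have -> : \sum_(j < p) \sum_(k < p) W j k * \int[P]_w (g j (Z j w) * g k (Z k w)) =
    \sum_(j < p) \sum_(k < p) W j k *
      (x j * x k * \int[P]_w (f j (X j w) * f k (X k w))).
  apply: eq_bigr => j _; apply: eq_bigr => k _; congr (_ * _).
  rewrite -RintegralZl//; last exact: Lfun2M_integrable.
  by apply: eq_Rintegral => w _; rewrite !gE mulrACA.
have -> : \sum_(j < p) \int[P]_w (g j (Z j w) ^+ 2) =
    \sum_(j < p) x j ^+ 2 * \int[P]_w (f j (X j w) ^+ 2).
  apply: eq_bigr => j _; rewrite -RintegralZl//; last exact: Lfun2_integrable_sqr.
  by apply: eq_Rintegral => w _; rewrite gE exprMn.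
apply.
- move=> j; apply: measurable_funM => //.
  by apply: measurableT_comp => //; case: (cf j).
- by move=> j; rewrite gF; exact: Lfun2Z.
- by move=> j; rewrite gF RintegralZl ?f0 ?mulr0//; exact: Lfun2_integrable.
Qed.

Lemma correlation_lambda_max_le (W : 'M[R]_p) (f : 'I_p -> R -> R) :
  W^T = W -> (forall j, centered_sq_integrable P (X j) (f j)) ->
  lambda_max (schur_prod (correlation_mx P (fun j w => f j (X j w))) W) <=
  lambda_max (schur_prod Sigma W).
Proof.
move=> symW cf; apply: lambda_max_le => //.
  by apply: schur_prod_symmetric => //; exact: correlation_mx_symmetric.
move=> x; pose s j := Num.sqrt (\int[P]_w (f j (X j w) ^+ 2)).
have v0 j : 0 < \int[P]_w (f j (X j w) ^+ 2).
  by case: (centered_sq_integrableP (mX j) (cf j)).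
have s0 j : s j != 0 by rewrite gt_eqF// sqrtr_gt0.
have := centered_bound (fun j => x j / s j) symW cf.
(* Dividing by the standard deviations turns the right side into the plain norm of [x] and, below,
   covariances into correlations. *)
have -> : \sum_(j < p) (x j / s j) ^+ 2 * \int[P]_w (f j (X j w) ^+ 2) =
    \sum_(j < p) x j ^+ 2.
  apply: eq_bigr => j _.
  have -> : \int[P]_w (f j (X j w) ^+ 2) = s j ^+ 2 by rewrite sqr_sqrtr// ltW.
  by rewrite -exprMn divfK.
apply: le_trans; rewrite le_eqVlt; apply/orP; left; apply/eqP.
apply: eq_bigr => j _; apply: eq_bigr => k _; rewrite !mxE /pearson.
have Ef i : 'E_P[fun w => f i (X i w)]%E = 0%E by case: (cf i).
rewrite fine_covariance// !fine_variance// -/(s j) -/(s k).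
by field; rewrite !s0.
Qed.

Lemma rhoNL_max_le (W : 'M[R]_p) : W^T = W ->
  (rhoNL_max P X W <= (lambda_max (schur_prod Sigma W))%:E)%E.
Proof.
move=> symW; apply: ge_ereal_sup => _ [f cf <-].
by rewrite lee_fin correlation_lambda_max_le.
Qed.

(** The inverses [g] are admissible functions whose correlation matrix is [Sigma] itself, so the
    bound is one of the values in the supremum. *)
Lemma le_rhoNL_max (W : 'M[R]_p) : (forall j, as_invertible P (Z j) (T j)) ->
  ((lambda_max (schur_prod Sigma W))%:E <= rhoNL_max P X W)%E.
Proof.
move=> inv.
have {}inv j : exists g : R -> R, measurable_fun [set: R] g /\
    {ae P, forall w, g (T j (Z j w)) = Z j w} by have [g] := inv j; exists g.
have [g gP] := choice inv.
have mg j : measurable_fun [set: R] (g j) := (gP j).1.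
have gae j : {ae P, forall w, g j (T j (Z j w)) = Z j w} := (gP j).2.
pose F j w := g j (X j w).
have mF j : measurable_fun [set: Omega] (F j) by exact: measurableT_comp.
(* [g j (X j)] agrees with [Z j] only almost surely; since correlations are built from expectations,
   this is enough. *)
have E_ae (H K : Omega -> R) : measurable_fun [set: Omega] H ->
    measurable_fun [set: Omega] K -> {ae P, forall w, H w = K w} ->
    'E_P[H]%E = 'E_P[K]%E.
  move=> mH mK HK; rewrite unlock; apply: ae_eq_integral => //.
  - exact/measurable_EFinP.
  - exact/measurable_EFinP.
  - by apply: filterS HK => w -> _.
have F0 j : 'E_P[F j]%E = 0%E.
  rewrite -(Z_mean j); apply: E_ae => //.
  by apply: filterS (gae j) => w <-; rewrite /F X_def.
have F_mul j k : 'E_P[fun w => (F j w * F k w)%R]%E = 'E_P[fun w => (Z j w * Z k w)%R]%E.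
  apply: E_ae; [exact: measurable_funM|exact: measurable_funM|].
  by apply: filterS2 (gae j) (gae k) => w <- <-; rewrite /F !X_def.
have F_sq j : 'E_P[fun w => (F j w ^+ 2)%R]%E = 1%E.
  by rewrite -(Z_sq j); under eq_fun do rewrite expr2; rewrite F_mul.
have cg j : centered_sq_integrable P (X j) (g j).
  have gX_sq : 'E_P[fun w => (g j (X j w) ^+ 2)%R]%E = 1%E by exact: F_sq.
  by split; [exact: mg|exact: F0|rewrite gX_sq lte01|rewrite gX_sq ltry].
apply: ereal_sup_ubound; exists g => //; congr (lambda_max (schur_prod _ W))%:E.
apply/matrixP => j k; rewrite !mxE /pearson.
have F_sq1 i : \int[P]_w (F i w ^+ 2) = 1 by rewrite -fine_expectation F_sq.
rewrite -/(F j) -/(F k) (fine_variance (F0 j)) (fine_variance (F0 k)).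
rewrite (fine_covariance (F0 j) (F0 k)) (fine_covariance (Z_mean j) (Z_mean k)).
rewrite !F_sq1 sqrtr1 mulr1 divr1.
by rewrite -!fine_expectation F_mul.
Qed.

End nonlinear_correlation.

Theorem corollary2 (d : measure_display) (Omega : measurableType d)
    (R : realType) (P : probability Omega R) (p : nat) (p_gt0 : (0 < p)%N)
    (Z : 'I_p -> {RV P >-> R}) (T : 'I_p -> R -> R) (X : 'I_p -> Omega -> R)
    (Z_gaussian : pairwise_gaussian Z)
    (Z_mean : forall j, 'E_P[Z j]%E = 0%E)
    (Z_sq : forall j, 'E_P[fun w => (Z j w ^+ 2)%R]%E = 1%E)
    (T_meas : forall j, measurable_fun [set: R] (T j))
    (X_def : forall j w, X j w = T j (Z j w))
    (X_var : forall j, (0 < variance P (X j) < +oo)%E) :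
  let Sigma := covariance_mx P (fun j => Z j) in
  (forall W : 'M[R]_p, W^T = W -> (forall j k, 0 <= W j k) ->
     [/\ ((lambda_min (schur_prod Sigma W))%:E <= rhoNL_min P X W)%E,
         (rhoNL_max P X W <= (lambda_max (schur_prod Sigma W))%:E)%E &
         (forall j, as_invertible P (Z j) (T j)) ->
           (lambda_min (schur_prod Sigma W))%:E = rhoNL_min P X W /\
           rhoNL_max P X W = (lambda_max (schur_prod Sigma W))%:E]) /\
  (forall f : 'I_p -> R -> R,
     (forall j, centered_sq_integrable P (X j) (f j)) ->
     ((lambda_min Sigma)%:E * (\sum_(j < p) 'E_P[fun w => (f j (X j w) ^+ 2)%R])
        <= 'E_P[fun w => ((\sum_(j < p) f j (X j w)) ^+ 2)%R])%E /\
     ('E_P[fun w => ((\sum_(j < p) f j (X j w)) ^+ 2)%R]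
        <= (lambda_max Sigma)%:E *
             (\sum_(j < p) 'E_P[fun w => (f j (X j w) ^+ 2)%R]))%E).
Proof.
move=> Sigma; split.
  move=> W symW _.
  have symNW : (- W)^T = - W by rewrite linearN/= symW.
  have ub (V : 'M[R]_p) : V^T = V ->
      (rhoNL_max P X V <= (lambda_max (schur_prod Sigma V))%:E)%E.
    by move=> symV; apply: rhoNL_max_le.
  have lb (V : 'M[R]_p) : (forall j, as_invertible P (Z j) (T j)) ->
      ((lambda_max (schur_prod Sigma V))%:E <= rhoNL_max P X V)%E.
    by move=> inv; apply: le_rhoNL_max.
  (* Both claims about minima are now claims about maxima for [- W]; this is why [ub] and [lb] are
     stated for a general matrix [V]. *)
  rewrite rhoNL_minE lambda_minE -schur_prodrN EFinN.
  split; [by rewrite leeN2 ub|exact: ub|move=> inv].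
  split; last by apply/eqP; rewrite eq_le ub// lb.
  by congr (- _)%E; apply/eqP; rewrite eq_le ub// lb.
move=> f cf.
have mX j : measurable_fun [set: Omega] (X j).
  by rewrite (_ : X j = (fun w => T j (Z j w))); [exact: measurableT_comp|exact/funext].
have f2 j : (fun w => f j (X j w)) \in Lfun P 2%:E.
  by case: (centered_sq_integrableP (mX j) (cf j)).
have sumE : (\sum_(j < p) 'E_P[fun w => (f j (X j w) ^+ 2)%R] =
    (\sum_(j < p) \int[P]_w (f j (X j w) ^+ 2))%:E)%E.
  rewrite -sumEFin; apply: eq_bigr => j _.
  by case: (centered_sq_integrableP (mX j) (cf j)).
have sqE w : (\sum_(j < p) f j (X j w)) ^+ 2 =
    \sum_(j < p) \sum_(k < p) f j (X j w) * f k (X k w).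
  by rewrite expr2 mulr_suml; apply: eq_bigr => j _; rewrite mulr_sumr.
have int_sq : 'E_P[fun w => ((\sum_(j < p) f j (X j w)) ^+ 2)%R]%E =
    (\sum_(j < p) \sum_(k < p) \int[P]_w (f j (X j w) * f k (X k w)))%:E.
  have i2 j k : P.-integrable [set: Omega]
      (EFin \o (fun w => f j (X j w) * f k (X k w))) by exact: Lfun2M_integrable.
  have i1 j : P.-integrable [set: Omega]
      (EFin \o (fun w => \sum_(k < p) f j (X j w) * f k (X k w))).
    exact: integrable_Rsum.
  have -> : \sum_(j < p) \sum_(k < p) \int[P]_w (f j (X j w) * f k (X k w)) =
      \int[P]_w ((\sum_(j < p) f j (X j w)) ^+ 2).
    under [RHS]eq_Rintegral do rewrite sqE.
    rewrite Rintegral_sum//; apply: eq_bigr => j _.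
    by rewrite Rintegral_sum.
  rewrite -fine_expectation fineK// unlock.
  apply: integrable_fin_num => //.
  rewrite (_ : (fun w => _) = EFin \o
      (fun w => \sum_(j < p) \sum_(k < p) f j (X j w) * f k (X k w))).
    exact: integrable_Rsum.
  by apply/funext => w /=; rewrite sqE.
(* Constant weights: the Schur product of [Sigma] with the constant matrix [c] is [c] times [Sigma].
   The value 1 gives the upper bound, and -1 the lower one. *)
have bound (c : R) := centered_bound p_gt0 Z_gaussian Z_mean Z_sq T_meas X_def
  (fun=> 1) (trmx_const p p c) cf.
rewrite sumE int_sq lambda_minE -!EFinM !lee_fin; split.
  have := bound (-1).
  have -> : schur_prod (covariance_mx P (fun j => Z j)) (const_mx (-1)) = - Sigma.
    by apply/matrixP => j k; rewrite !mxE mulrN1.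
  under [in X in X -> _]eq_bigr do under eq_bigr do rewrite mxE !mul1r mulN1r.
  under [in X in X -> _]eq_bigr do rewrite sumrN.
  under [in X in _ <= X -> _]eq_bigr do rewrite expr1n mul1r.
  by rewrite sumrN mulNr lerNl.
have := bound 1.
have -> : schur_prod (covariance_mx P (fun j => Z j)) (const_mx 1) = Sigma.
  by apply/matrixP => j k; rewrite !mxE mulr1.
under [in X in X -> _]eq_bigr do under eq_bigr do rewrite mxE !mul1r.
by under [in X in _ <= X -> _]eq_bigr do rewrite expr1n mul1r.
Qed.
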